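(* Let $a_1,a_2,a_3,a_4\in\mathbb R$ with $a_1a_4=a_2a_3$. The almost contact metric manifold $M^5(a_1,a_2,a_3,a_4)$ is a generalized quasi-Sasaki manifold. In addition it has the following properties, where $\alpha:=-2\big((a_1-a_3)(2a_1+a_3)+(a_2-a_4)(2a_2+a_4)\big)$ and $F:=e_1\wedge e_2-e_3\wedge e_4$: a) The Nijenhuis tensor $N$ satisfies $N(\xi,X,Y)=2\,d\eta(X,Y)$. Moreover, $N$ is totally skew-symmetric if and only if $a_3=a_4=0$, and $N$ is traceless cyclic if and only if $a_1=a_2=0$. b) The $2$-form $F$ is closed. c) The curvature tensor $R^c:\Lambda^2\to\mathfrak u(2)$ of the connection $\nabla^c$ is proportional to the projection onto $\{t\cdot F\mid t\in\mathbb R\}$: $R^c=\alpha\cdot F\otimes F$. d) The Ricci tensor of $\nabla^c$ is $\mathrm{Ric}^c=-\alpha\cdot\mathrm{diag}(1,1,1,1,0)$ with respect to $(e_1,\dots,e_5)$. e) There exist two (linearly independent) $\nabla^c$-parallel spinor fields in the subbundle of the spin bundle defined by the Clifford product $F\cdot\Psi=0$.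
   Context: An almost contact metric structure on a Riemannian $5$-manifold $(M^5,g)$ is a triple $(\xi,\eta,\varphi)$: a unit vector field $\xi$, its dual $1$-form $\eta$, and an endomorphism $\varphi$ of $TM^5$ with $\varphi(\xi)=0$, $\varphi^2=-\mathrm{Id}+\eta\otimes\xi$, $g(\varphi(X),\varphi(Y))=g(X,Y)-\eta(X)\eta(Y)$. Its fundamental form is $\Phi(X,Y):=g(X,\varphi(Y))$. An adapted frame is an oriented orthonormal frame $(e_1,\dots,e_5)$ with $\Phi=e_1\wedge e_2+e_3\wedge e_4$, $\eta=e_5$ ($TM^5$ is identified with its dual via $g$). $\nabla^g$ is the Levi-Civita connection, $d\eta(X,Y)=(\nabla^g_X\eta)(Y)-(\nabla^g_Y\eta)(X)$, and $(\beta\wedge\eta)(X,Y,Z)=\beta(X,Y)\eta(Z)+\beta(Y,Z)\eta(X)+\beta(Z,X)\eta(Y)$ for a $2$-form $\beta$. The Nijenhuis tensor is $N(X,Y,Z):=g(X,[\varphi,\varphi](Y,Z))+\eta(X)\,d\eta(Y,Z)$, where $[\varphi,\varphi](X,Y)=[\varphi(X),\varphi(Y)]+\varphi^2([X,Y])-\varphi([\varphi(X),Y])-\varphi([X,\varphi(Y)])$. $N$ is totally skew-symmetric if $N(X,Y,Z)+N(Y,X,Z)=0$; traceless cyclic if $N(X,Y,Z)+N(Y,Z,X)+N(Z,X,Y)=0$ and $\sum_iN(e_i,e_i,X)=0$. A generalized quasi-Sasaki manifold is an almost contact metric $5$-manifold such that (i) $N(X,Y,Z)=0$ and $d\Phi(X,Y,Z)=0$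 for all $X,Y,Z$ orthogonal to $\xi$; (ii) $\xi$ is a Killing vector field for $g$. On such a manifold $\nabla^c$ denotes the metric connection $$g(\nabla^c_XY,Z)=g(\nabla^g_XY,Z)+\tfrac12\{((d\eta-\gamma)\wedge\eta)(X,Y,Z)-N(X,Y,Z)\},\quad\gamma(X,Y):=d\Phi(\xi,\varphi(X),Y);$$ it satisfies $\nabla^c\xi=0$, $\nabla^c\eta=0$, $\nabla^c\varphi=0$. Construction of $M^5(a_1,a_2,a_3,a_4)$. Let $a_1a_4=a_2a_3$. There is a $6$-dimensional Lie group $G(a_1,a_2,a_3,a_4)$ with a basis $e_1,\dots,e_5,A_2$ of its left invariant $1$-forms satisfying $$\begin{aligned} de_1&=A_2\wedge e_2-(2a_1+a_3)e_3\wedge e_5-(2a_2+a_4)e_4\wedge e_5,\\ de_2&=-A_2\wedge e_1+(2a_1+a_3)e_4\wedge e_5-(2a_2+a_4)e_3\wedge e_5,\\ de_3&=-A_2\wedge e_4+(2a_1+a_3)e_1\wedge e_5+(2a_2+a_4)e_2\wedge e_5,\\ de_4&=A_2\wedge e_3-(2a_1+a_3)e_2\wedge e_5+(2a_2+a_4)e_1\wedge e_5,\\ de_5&=-2(a_1-a_3)(e_1\wedge e_3-e_2\wedge e_4)-2(a_2-a_4)(e_1\wedge e_4+e_2\wedge e_3),\\ dA_2&=\alpha\,(e_1\wedge e_2-e_3\wedge e_4). \end{aligned}$$ Let $M^5$ be a ($5$-dimensional) submanifold of $G(a_1,a_2,a_3,a_4)$ on which the restrictions of $e_1,\dots,e_5$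 are linearly independent. $M^5(a_1,a_2,a_3,a_4)$ is $M^5$ with the Riemannian metric and almost contact metric structure for which $(e_1,\dots,e_5)$ is an adapted frame; it carries the spin structure induced by this global frame. Curvature conventions: $\Lambda^2$ is identified with $\mathfrak{so}(5)$; $R^c=\alpha F\otimes F$ means $g(R^c(X,Y)Z,W)=\alpha F(X,Y)F(Z,W)$ with $R^c(X,Y)=\nabla^c_X\nabla^c_Y-\nabla^c_Y\nabla^c_X-\nabla^c_{[X,Y]}$, and $\mathrm{Ric}^c(Y,Z)=\sum_ig(R^c(e_i,Y)Z,e_i)$. Here $\mathfrak u(2)\subset\Lambda^2$ is the space of $2$-forms $\beta$ with $\beta(\varphi(X),\varphi(Y))=\beta(X,Y)$. *)

(* Defs.v *)
From HB Require Import structures.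
From mathcomp Require Import all_boot all_order all_algebra.
From mathcomp Require Import all_classical all_reals all_analysis.
From mathcomp Require Import complex.

Set Implicit Arguments.
Unset Strict Implicit.
Unset Printing Implicit Defensive.

Import Order.TTheory GRing.Theory Num.Theory.
Import numFieldNormedType.Exports.

Local Open Scope classical_set_scope.
Local Open Scope ring_scope.

(* In finite dimension, [Ck k U f] says that the iterated directional
   derivatives of [f] of order at most [k] exist and are continuous on [U]. *)
Fixpoint Ck (R : realType) (V W : normedModType R) (k : nat)
    (U : set V) (f : V -> W) : Prop :=
  match k with
  | 0 => forall x, U x -> {for x, continuous f}
  | k'.+1 => (forall x, U x -> differentiable f x) /\
             (forall v, Ck k' U (fun x => 'D_v f x))
  end.

Definition smooth_on (R : realType) (V W : normedModType R)
    (U : set V) (f : V -> W) : Prop := forall k, Ck k U f.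

Definition smooth_at (R : realType) (V W : normedModType R)
    (f : V -> W) (x : V) : Prop :=
  exists U : set V, [/\ open U, U x & smooth_on U f].

(* The smooth structure is given by an atlas indexed by the points: [chart p]
   is a chart around [p], meaningful only on [chart_dom p], with inverse
   [chart_inv p], meaningful only on [chart p @` chart_dom p].  The tangent
   space at [p] is 'rV[R]_n, read in the chart [chart p]. *)
Record manifold (R : realType) (n : nat) := Manifold {
  carrier :> topologicalType ;
  chart_dom : carrier -> set carrier ;
  chart : carrier -> carrier -> 'rV[R]_n ;
  chart_inv : carrier -> 'rV[R]_n -> carrier ;
  manifold_nonempty : exists p : carrier, True ;
  manifold_hausdorff : hausdorff_space carrier ;
  manifold_second_countable : @second_countable carrier ;
  chart_dom_open : forall p, open (chart_dom p) ;
  chart_dom_mem : forall p, chart_dom p p ;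
  chart_img_open : forall p, open (chart p @` chart_dom p) ;
  chartK : forall p q, chart_dom p q -> chart_inv p (chart p q) = q ;
  chart_continuous : forall p q, chart_dom p q ->
    {for q, continuous (chart p)} ;
  chart_inv_continuous : forall p x, (chart p @` chart_dom p) x ->
    {for x, continuous (chart_inv p)} ;
  chart_transition : forall p q,
    smooth_on (chart p @` (chart_dom p `&` chart_dom q))
              (chart q \o chart_inv p)
}.

Section Calculus.
Variables (R : realType) (n : nat) (M : manifold R n).

Definition smooth_fun (W : normedModType R) (f : M -> W) : Prop :=
  forall p, smooth_at (f \o chart_inv p) (chart p p).

Definition ddir (W : normedModType R) (f : M -> W) (p : M) (v : 'rV[R]_n) : W :=
  'D_v (f \o chart_inv p) (chart p p).

Definition vfield := M -> 'rV[R]_n.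

(* [fun q => ddir (chart p) q (X q)] is the field X read in the chart at p. *)
Definition smooth_vfield (X : vfield) : Prop :=
  forall p, smooth_at ((fun q => ddir (chart p) q (X q)) \o chart_inv p)
                      (chart p p).

Definition lie_bracket (X Y : vfield) : vfield := fun p =>
  ddir (fun q => ddir (chart p) q (Y q)) p (X p) -
  ddir (fun q => ddir (chart p) q (X q)) p (Y p).

Definition Xderiv (X : vfield) (f : M -> R) : M -> R :=
  fun p => ddir f p (X p).

Definition oneform := M -> 'rV[R]_n -> R.

Definition oneform_app (w : oneform) (X : vfield) : M -> R :=
  fun p => w p (X p).

(* The coefficients of w in the chart at p: the second argument of w is the
   coordinate vector v of the chart at p, at the point of coordinates x. *)
Definition smooth_oneform (w : oneform) : Prop :=
  (forall p, scalar (w p)) /\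
  (forall p v, smooth_at
     (fun x => w (chart_inv p x)
                 ('D_v (chart (chart_inv p x) \o chart_inv p) x)) (chart p p)).

(* Forms of degree 2 and 3, and trilinear tensors, are given by their values on
   vector fields, and only their values on smooth vector fields matter. *)
Definition twotensor := vfield -> vfield -> M -> R.
Definition threetensor := vfield -> vfield -> vfield -> M -> R.

Definition eq_two (b c : twotensor) : Prop :=
  forall X Y, smooth_vfield X -> smooth_vfield Y -> forall p, b X Y p = c X Y p.

Definition twoform (b : twotensor) : Prop :=
  [/\ forall X Y, smooth_vfield X -> smooth_vfield Y ->
        smooth_fun (b X Y),
      eq_two b (fun X Y p => - b Y X p) &
      forall X Y Z (f : M -> R), smooth_vfield X -> smooth_vfield Y ->
        smooth_vfield Z -> smooth_fun f -> forall p,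
        b (fun q => f q *: X q + Y q) Z p = f p * b X Z p + b Y Z p].

Definition wedge11 (v w : oneform) : twotensor :=
  fun X Y p => v p (X p) * w p (Y p) - v p (Y p) * w p (X p).

Definition wedge21 (b : twotensor) (w : oneform) : threetensor :=
  fun X Y Z p =>
    b X Y p * w p (Z p) + b Y Z p * w p (X p) + b Z X p * w p (Y p).

(* Exterior derivatives, normalised without the factors 1/2 and 1/3, so that
   d w (X, Y) = (nabla_X w)(Y) - (nabla_Y w)(X) for a torsion-free nabla. *)
Definition d1 (w : oneform) : twotensor := fun X Y p =>
  Xderiv X (oneform_app w Y) p - Xderiv Y (oneform_app w X) p
  - w p (lie_bracket X Y p).

Definition d2 (b : twotensor) : threetensor := fun X Y Z p =>
  Xderiv X (b Y Z) p + Xderiv Y (b Z X) p + Xderiv Z (b X Y) p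
  - b (lie_bracket X Y) Z p - b (lie_bracket Y Z) X p
  - b (lie_bracket Z X) Y p.

Definition bilinear_field := M -> 'rV[R]_n -> 'rV[R]_n -> R.

Definition inner (g : bilinear_field) (X Y : vfield) : M -> R :=
  fun p => g p (X p) (Y p).

Definition riemannian_metric (g : bilinear_field) : Prop :=
  [/\ forall p u, scalar (g p u),
      forall p u v, g p u v = g p v u,
      forall p u, u != 0 -> 0 < g p u u &
      forall X Y, smooth_vfield X -> smooth_vfield Y ->
        smooth_fun (inner g X Y)].

(* Only the values of a connection on smooth vector fields matter. *)
Definition connection := vfield -> vfield -> vfield.

Definition affine_connection (D : connection) : Prop :=
  [/\ forall X Y, smooth_vfield X -> smooth_vfield Y -> smooth_vfield (D X Y),
      forall (f : M -> R) X Y Z, smooth_fun f ->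
        smooth_vfield X -> smooth_vfield Y -> smooth_vfield Z -> forall p,
        D (fun q => f q *: X q + Y q) Z p = f p *: D X Z p + D Y Z p,
      forall X Y Z, smooth_vfield X -> smooth_vfield Y -> smooth_vfield Z ->
        forall p, D X (fun q => Y q + Z q) p = D X Y p + D X Z p &
      forall (f : M -> R) X Y, smooth_fun f ->
        smooth_vfield X -> smooth_vfield Y -> forall p,
        D X (fun q => f q *: Y q) p = Xderiv X f p *: Y p + f p *: D X Y p].

Definition metric_connection (g : bilinear_field) (D : connection) : Prop :=
  affine_connection D /\
  forall X Y Z, smooth_vfield X -> smooth_vfield Y -> smooth_vfield Z ->
    forall p, Xderiv X (inner g Y Z) p =
              inner g (D X Y) Z p + inner g Y (D X Z) p.

Definition levi_civita (g : bilinear_field) (D : connection) : Prop :=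
  metric_connection g D /\
  forall X Y, smooth_vfield X -> smooth_vfield Y ->
    forall p, D X Y p - D Y X p = lie_bracket X Y p.

Definition curvature (D : connection) (X Y Z : vfield) : vfield := fun p =>
  D X (D Y Z) p - D Y (D X Z) p - D (lie_bracket X Y) Z p.

Definition killing (g : bilinear_field) (K : vfield) : Prop :=
  smooth_vfield K /\
  forall X Y, smooth_vfield X -> smooth_vfield Y -> forall p,
    Xderiv K (inner g X Y) p =
    inner g (lie_bracket K X) Y p + inner g X (lie_bracket K Y) p.

Definition endo := M -> 'rV[R]_n -> 'rV[R]_n.

Definition endo_app (phi : endo) (X : vfield) : vfield :=
  fun p => phi p (X p).

Definition smooth_endo (phi : endo) : Prop :=
  (forall p, linear (phi p)) /\
  (forall X, smooth_vfield X -> smooth_vfield (endo_app phi X)).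

End Calculus.

Section Maps.
Variable R : realType.

Definition smooth_map m n (M : manifold R m) (N : manifold R n)
    (f : M -> N) : Prop :=
  continuous f /\
  forall p, smooth_at (chart (f p) \o f \o chart_inv p) (chart p p).

Definition dmap m n (M : manifold R m) (N : manifold R n) (f : M -> N)
    (p : M) (v : 'rV[R]_m) : 'rV[R]_n := ddir (chart (f p) \o f) p v.

Definition pullback m n (M : manifold R m) (N : manifold R n) (f : M -> N)
    (w : oneform N) : oneform M := fun p v => w (f p) (dmap f p v).

(* inclusion of an immersed (in particular, of an embedded) submanifold *)
Definition submanifold m n (M : manifold R m) (N : manifold R n)
    (f : M -> N) : Prop :=
  [/\ smooth_map f, injective f & forall p, injective (dmap f p)].

Record lieGroup n := LieGroup {
  lg_manifold :> manifold R n ;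
  lg_mul : lg_manifold -> lg_manifold -> lg_manifold ;
  lg_one : lg_manifold ;
  lg_inv : lg_manifold -> lg_manifold ;
  lg_mulA : associative lg_mul ;
  lg_mul1 : left_id lg_one lg_mul ;
  lg_mulV : left_inverse lg_one lg_inv lg_mul ;
  lg_mul_continuous :
    continuous (fun z : lg_manifold * lg_manifold => lg_mul z.1 z.2) ;
  lg_mul_smooth : forall p q,
    smooth_at
      (fun z : 'rV[R]_n * 'rV[R]_n =>
         chart (lg_mul p q) (lg_mul (chart_inv p z.1) (chart_inv q z.2)))
      (chart p p, chart q q) ;
  lg_inv_smooth : smooth_map lg_inv
}.

Definition left_invariant n (G : lieGroup n) (w : oneform G) : Prop :=
  smooth_oneform w /\
  forall (h q : G) v, pullback (lg_mul h) w q v = w q v.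

Definition left_invariant_basis n k (G : lieGroup n)
    (s : k.-tuple (oneform G)) : Prop :=
  (forall i, left_invariant (tnth s i)) /\
  forall w : oneform G, left_invariant w ->
    exists! c : 'rV[R]_k,
      forall q v, w q v = \sum_(i < k) c 0 i * tnth s i q v.

End Maps.

Definition i1 : 'I_5 := @Ordinal 5 0 isT.
Definition i2 : 'I_5 := @Ordinal 5 1 isT.
Definition i3 : 'I_5 := @Ordinal 5 2 isT.
Definition i4 : 'I_5 := @Ordinal 5 3 isT.
Definition i5 : 'I_5 := @Ordinal 5 4 isT.

Section AlmostContact.
Variables (R : realType) (M : manifold R 5).
Variables (g : bilinear_field M) (xi : vfield M) (eta : oneform M)
          (phi : endo M).

Definition almost_contact_metric : Prop :=
  riemannian_metric g /\
  [/\ smooth_vfield xi,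
      forall p, g p (xi p) (xi p) = 1,
      forall p v, eta p v = g p (xi p) v &
      smooth_endo phi] /\
  [/\ forall p, phi p (xi p) = 0,
      forall p v, phi p (phi p v) = - v + eta p v *: xi p &
      forall p u v, g p (phi p u) (phi p v) = g p u v - eta p u * eta p v].

Definition Phi : twotensor M := fun X Y p => g p (X p) (phi p (Y p)).

Definition flat (X : vfield M) : oneform M := fun p v => g p (X p) v.

(* The orientation is the one of the nowhere vanishing form
   eta /\ Phi /\ Phi, so every frame as below is oriented. *)
Definition adapted_frame (E : 'I_5 -> vfield M) : Prop :=
  [/\ forall i, smooth_vfield (E i),
      forall i j p, g p (E i p) (E j p) = (i == j)%:R,
      eq_two Phi (fun X Y p =>
        wedge11 (flat (E i1)) (flat (E i2)) X Y p +
        wedge11 (flat (E i3)) (flat (E i4)) X Y p) &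
      forall p v, eta p v = flat (E i5) p v].

Definition nijenhuis_bracket (X Y : vfield M) : vfield M := fun p =>
  lie_bracket (endo_app phi X) (endo_app phi Y) p
  + phi p (phi p (lie_bracket X Y p))
  - phi p (lie_bracket (endo_app phi X) Y p)
  - phi p (lie_bracket X (endo_app phi Y) p).

Definition nijenhuis : threetensor M := fun X Y Z p =>
  g p (X p) (nijenhuis_bracket Y Z p) + eta p (X p) * d1 eta Y Z p.

Definition totally_skew (N : threetensor M) : Prop :=
  forall X Y Z, smooth_vfield X -> smooth_vfield Y -> smooth_vfield Z ->
    forall p, N X Y Z p + N Y X Z p = 0.

Definition traceless_cyclic (E : 'I_5 -> vfield M) (N : threetensor M) : Prop :=
  (forall X Y Z, smooth_vfield X -> smooth_vfield Y -> smooth_vfield Z ->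
    forall p, N X Y Z p + N Y Z X p + N Z X Y p = 0) /\
  (forall X, smooth_vfield X -> forall p, \sum_(i < 5) N (E i) (E i) X p = 0).

Definition orthogonal_to_xi (X : vfield M) : Prop :=
  forall p, g p (X p) (xi p) = 0.

Definition generalized_quasi_sasaki : Prop :=
  [/\ almost_contact_metric,
      forall X Y Z, smooth_vfield X -> smooth_vfield Y -> smooth_vfield Z ->
        orthogonal_to_xi X -> orthogonal_to_xi Y -> orthogonal_to_xi Z ->
        forall p, nijenhuis X Y Z p = 0 /\ d2 Phi X Y Z p = 0 &
      killing g xi].

Definition gamma_form : twotensor M :=
  fun X Y p => d2 Phi xi (endo_app phi X) Y p.

(* [Dg] is meant to be the Levi-Civita connection of g; the formula determines
   Dc, and metricity follows from it on generalized quasi-Sasaki manifolds. *)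
Definition canonical_connection (Dg Dc : connection M) : Prop :=
  metric_connection g Dc /\
  forall X Y Z, smooth_vfield X -> smooth_vfield Y -> smooth_vfield Z ->
    forall p, inner g (Dc X Y) Z p = inner g (Dg X Y) Z p +
      2^-1 * (wedge21 (fun U V q => d1 eta U V q - gamma_form U V q) eta X Y Z p
              - nijenhuis X Y Z p).

Definition in_u2 (b : twotensor M) : Prop :=
  twoform b /\
  forall X Y, smooth_vfield X -> smooth_vfield Y -> forall p,
    b (endo_app phi X) (endo_app phi Y) p = b X Y p.

(* scalar product of 2-forms for which the e_i /\ e_j, i < j, are orthonormal *)
Definition inner_two (E : 'I_5 -> vfield M) (b c : twotensor M) : M -> R :=
  fun p => \sum_(i < 5) \sum_(j < 5 | (i < j)%N) b (E i) (E j) p * c (E i) (E j) p.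

Definition proj_two (E : 'I_5 -> vfield M) (c b : twotensor M) : twotensor M :=
  fun X Y p => inner_two E b c p / inner_two E c c p * c X Y p.

(* curvature as an operator on 2-forms: e_i /\ e_j |-> g(R(e_i, e_j) -, -) *)
Definition curvature_operator (E : 'I_5 -> vfield M) (D : connection M)
    (b : twotensor M) : twotensor M := fun Z W p =>
  \sum_(i < 5) \sum_(j < 5 | (i < j)%N)
    b (E i) (E j) p * inner g (curvature D (E i) (E j) Z) W p.

Definition ricci (E : 'I_5 -> vfield M) (D : connection M) : twotensor M :=
  fun Y Z p => \sum_(i < 5) inner g (curvature D (E i) Y Z) (E i) p.

End AlmostContact.

(* Spinor module in dimension 5: the complex dimension 4 forces irreducibility.
   Both inequivalent modules are allowed.  Convention v . v = - |v|^2. *)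
Definition clifford_module (R : realType) (c : 'I_5 -> 'M[R[i]]_4) : Prop :=
  forall i j, c i *m c j + c j *m c i = (- (2 * (i == j)%:R))%:M.

Section Spinors.
Variables (R : realType) (M : manifold R 5).
Variables (c : 'I_5 -> 'M[R[i]]_4).
Variables (g : bilinear_field M) (E : 'I_5 -> vfield M).

(* Sections of the spin bundle of the spin structure induced by the global frame
   E, which trivialises it. *)
Definition spinor := M -> 'cV[R[i]]_4.

Definition smooth_spinor (Psi : spinor) : Prop :=
  forall k, smooth_fun (fun q => complex.Re (Psi q k 0)) /\
            smooth_fun (fun q => complex.Im (Psi q k 0)).

Definition spinor_deriv (X : vfield M) (Psi : spinor) : spinor := fun p =>
  \col_k Complex (Xderiv X (fun q => complex.Re (Psi q k 0)) p)
                 (Xderiv X (fun q => complex.Im (Psi q k 0)) p).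

Definition clifford_two (b : twotensor M) (Psi : spinor) : spinor := fun p =>
  \sum_(i < 5) \sum_(j < 5 | (i < j)%N)
    (b (E i) (E j) p)%:C%C *: (c i *m (c j *m Psi p)).

(* Lift of the metric connection D to the spin bundle; with the convention
   v . v = - |v|^2 it satisfies D_X(Y . Psi) = D_X Y . Psi + Y . D_X Psi. *)
Definition spin_connection (D : connection M) (X : vfield M)
    (Psi : spinor) : spinor := fun p =>
  spinor_deriv X Psi p + 2^-1 *: (\sum_(i < 5) \sum_(j < 5 | (i < j)%N)
    (inner g (D X (E i)) (E j) p)%:C%C *: (c i *m (c j *m Psi p))).

Definition parallel_spinor (D : connection M) (Psi : spinor) : Prop :=
  smooth_spinor Psi /\
  forall X, smooth_vfield X -> forall p, spin_connection D X Psi p = 0.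

End Spinors.

Definition structure_equations (R : realType) (a1 a2 a3 a4 alpha : R)
    (G : lieGroup R 6) (e1 e2 e3 e4 e5 A2 : oneform G) : Prop :=
  [/\ eq_two (d1 e1) (fun X Y q =>
        wedge11 A2 e2 X Y q - (2 * a1 + a3) * wedge11 e3 e5 X Y q
        - (2 * a2 + a4) * wedge11 e4 e5 X Y q),
      eq_two (d1 e2) (fun X Y q =>
        - wedge11 A2 e1 X Y q + (2 * a1 + a3) * wedge11 e4 e5 X Y q
        - (2 * a2 + a4) * wedge11 e3 e5 X Y q),
      eq_two (d1 e3) (fun X Y q =>
        - wedge11 A2 e4 X Y q + (2 * a1 + a3) * wedge11 e1 e5 X Y q
        + (2 * a2 + a4) * wedge11 e2 e5 X Y q) &
      eq_two (d1 e4) (fun X Y q =>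
        wedge11 A2 e3 X Y q - (2 * a1 + a3) * wedge11 e2 e5 X Y q
        + (2 * a2 + a4) * wedge11 e1 e5 X Y q)] /\
  eq_two (d1 e5) (fun X Y q =>
    - (2 * (a1 - a3)) * (wedge11 e1 e3 X Y q - wedge11 e2 e4 X Y q)
    - 2 * (a2 - a4) * (wedge11 e1 e4 X Y q + wedge11 e2 e3 X Y q)) /\
  eq_two (d1 A2) (fun X Y q =>
    alpha * (wedge11 e1 e2 X Y q - wedge11 e3 e4 X Y q)).

Definition coframe_independent (R : realType) (M : manifold R 5)
    (e : 'I_5 -> oneform M) : Prop :=
  forall p (c : 'rV[R]_5),
    (forall v, \sum_(i < 5) c 0 i * e i p v = 0) -> c = 0.

(* Main.v *)
(* Since the six forms are a basis of the left invariant forms, they are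
   linearly independent at every point, and the dual fields are smooth: so every
   tangent vector of G extends to a smooth field, the structure equations hold
   pointwise, and they can be pulled back to M because d commutes with pullbacks
   (Schwarz's theorem).

   On M everything is expressed in the frame E: the components of a bracket are
   e_i([X,Y]) = X(e_i(Y)) - Y(e_i(X)) - de_i(X,Y), so N, dPhi and the Levi-Civita
   connection (Koszul formula) are computed from the structure equations alone.
   With A the restriction of A_2, one finds that the connection form of nabla^c
   is A F, that is, g(nabla^c_X E_i, E_j) = A(X) F(E_i, E_j).  Hence
   R^c = dA F = alpha F F, and the spin connection differentiates along X by
   X + A(X)/2 (e_1 e_2 - e_3 e_4): the constant spinors in the kernel of the
   Clifford action of F, which has dimension 2, are parallel. *)

From HB Require Import structures.
Require Import Defs.
From mathcomp Require Import all_boot all_order all_algebra.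
From mathcomp Require Import all_classical all_reals all_analysis.
From mathcomp Require Import complex.
From mathcomp Require Import ring lra.

Import Order.TTheory GRing.Theory Num.Theory.
Import numFieldNormedType.Exports.
Set Implicit Arguments.
Unset Strict Implicit.
Unset Printing Implicit Defensive.
Local Open Scope classical_set_scope.
Local Open Scope ring_scope.

(** * Differential calculus *)

(** The computation closes because [A] enters the structure equations as an infinitesimal rotation
    by F, with opposite speeds in the planes (e_1, e_2) and (e_3, e_4). Such a rotation preserves g,
    φ and ξ, so [A] drops out of N, of dΦ and of the Killing equation, while the torsion of ∇^c
    absorbs exactly the terms with coefficients in the a_i. The connection form takes its values in
    a line, an abelian Lie algebra, so the curvature has no quadratic term in [A].

    The obstacle is the passage from G to M: a smooth map does not carry fields to fields, whereas
    2-forms are functions of fields here. Therefore the exterior derivative of a 1-form is first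
    shown to depend only on the values of the fields at one point, through the bilinear form [dform]
    read in a single chart. Fields on M and on G then need to be related at that point only. *)

Section Differentiability.
Context {R : realType} {V W : normedModType R}.
Implicit Types (f g : V -> W) (x v : V).

(** The first-order expansion of [f] at [x] is also one for [g], with the same linear part;
    [diff_unique] identifies this part with the differential of [g]. *)
Lemma near_eq_differentiable f g x :
  (\forall y \near x, f y = g y) -> differentiable f x -> differentiable g x.
Proof.
move=> fg df.
have fgx : f x = g x := nbhs_singleton fg.
have dfc : continuous ('d f x) by exact: diff_continuous.
have gE : g \o shift x = cst (g x) + 'd f x +o_ 0 id.
  have /eqaddoP fo := diff_locally df.
  apply/eqaddoP => e e0; have := fo e e0.
  apply: filter_app; rewrite -fgx.
  move: fg; rewrite (near_shift 0) subr0 => fg.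
  near=> h; suff -> : (f \o shift x - (cst (f x) + 'd f x)) h =
                      (g \o shift x - (cst (f x) + 'd f x)) h by [].
  have fgh : f (h + x) = g (h + x) by near: h.
  by congr (_ - _).
by apply/diff_locallyP; rewrite (diff_unique dfc gE); split.
Unshelve. all: by end_near. Qed.

Lemma near_eq_continuous f g x :
  (\forall y \near x, f y = g y) -> {for x, continuous f} ->
  {for x, continuous g}.
Proof.
move=> fg fc; rewrite /prop_for /continuous_at -(nbhs_singleton fg).
apply: cvg_trans fc; apply: near_eq_cvg; near=> y.
by have -> : f y = g y by near: y.
Unshelve. all: by end_near. Qed.

End Differentiability.

Section Ck.
Context {R : realType} {V W : normedModType R}.
Implicit Types (f g : V -> W) (x v : V) (U : set V).

Lemma open_near_eq U f g x : open U -> U x -> {in U, f =1 g} ->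
  \forall y \near x, f y = g y.
Proof.
move=> oU Ux fg; near=> y; apply: fg; rewrite inE; near: y.
exact: open_nbhs_nbhs.
Unshelve. all: by end_near. Qed.

(** Since [U] is open, equality on [U] is equality near each of its points, which makes the
    directional derivatives agree. *)
Lemma Ck_ext k U f g : open U -> {in U, f =1 g} -> Ck k U f -> Ck k U g.
Proof.
move=> oU; elim: k f g => [|k IH] f g fg /=.
  by move=> fc x Ux; apply: near_eq_continuous (fc x Ux);
    exact: (open_near_eq oU Ux fg).
move=> [fd fk]; split.
  by move=> x Ux; apply: near_eq_differentiable (fd x Ux);
    exact: (open_near_eq oU Ux fg).
move=> v; apply: IH (fk v) => x; rewrite inE => Ux.
by apply: near_eq_derive;
    exact: (open_near_eq oU Ux fg).
Qed.

Lemma Ck_sub k U U' f : U' `<=` U -> Ck k U f -> Ck k U' f.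
Proof.
move=> UU; elim: k f => [|k IH] f /=; first by move=> fc x /UU; exact: fc.
by move=> [fd fk]; split=> [x /UU|v]; [exact: fd|exact/IH/fk].
Qed.

Lemma CkW k U f : Ck k.+1 U f -> Ck k U f.
Proof.
elim: k f => [|k IH] f /= [fd fk].
  by move=> x /fd /differentiable_continuous.
by split=> // v; apply: IH; exact: fk.
Qed.

Lemma Ck_cst k U (w : W) : Ck k U (fun=> w).
Proof.
elim: k w => [|k IH] w /=; first by move=> x _; exact: cvg_cst.
split=> [x _|v]; first exact: differentiable_cst.
have -> : (fun x => 'D_v (fun=> w : W) x) = (fun x : V => 0 : W).
  by apply/funext => x; exact: derive_cst.
exact: IH.
Qed.

Lemma CkD k U f g : open U -> Ck k U f -> Ck k U g -> Ck k U (fun x => f x + g x).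
Proof.
move=> oU; elim: k f g => [|k IH] f g /=.
  by move=> fc gc x Ux; apply: cvgD; [exact: fc|exact: gc].
move=> [fd fk] [gd gk]; split=> [x Ux|v].
  by apply: differentiableD; [exact: fd|exact: gd].
apply: Ck_ext (IH _ _ (fk v) (gk v)) => // x; rewrite inE => Ux.
by rewrite -deriveD //; apply: diff_derivable; [exact: fd|exact: gd].
Qed.

End Ck.

Section CkScalar.
Context {R : realType} {V : normedModType R}.
Implicit Types (f g : V -> R) (x v : V) (U : set V).

(** The Leibniz rule leaves one factor undifferentiated; [CkW] lowers that factor to the order of
    the induction hypothesis. *)
Lemma CkM k U f g : open U -> Ck k U f -> Ck k U g -> Ck k U (fun x => f x * g x).
Proof.
move=> oU; elim: k f g => [|k IH] f g.
  by move=> /= fc gc x Ux; apply: cvgM; [exact: fc|exact: gc].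
move=> fk1 gk1; have [fd fk] := fk1; have [gd gk] := gk1.
split=> [x Ux|v].
  by apply: differentiableM; [exact: fd|exact: gd].
apply: Ck_ext (CkD oU (IH _ _ (CkW fk1) (gk v)) (IH _ _ (CkW gk1) (fk v))) => //.
move=> x; rewrite inE => Ux.
by rewrite [RHS]deriveM //; apply: diff_derivable; [exact: fd|exact: gd].
Qed.

Lemma CkV k U f : open U -> (forall x, U x -> f x != 0) ->
  Ck k U f -> Ck k U (fun x => (f x)^-1).
Proof.
move=> oU f0; elim: k => [|k IH].
  by move=> /= fc x Ux; apply: cvgV; [exact: f0|exact: fc].
move=> fk1; have [fd fk] := fk1; split=> [x Ux|v].
  by apply: differentiableV; [exact: fd|exact: f0].
have IH' := IH (CkW fk1).
have c1 : Ck k U (fun=> -1 : R) by exact: Ck_cst.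
(* The derivative of 1/f is -f'/f^2, and the induction hypothesis covers both factors 1/f. *)
apply: Ck_ext (CkM oU c1 (CkM oU (CkM oU IH' IH') (fk v))) => //.
move=> x; rewrite inE => Ux.
rewrite [RHS]deriveV; [|exact: f0|by apply: diff_derivable; exact: fd].
by rewrite /GRing.scale /= expr2 invfM mulN1r mulNr.
Qed.

End CkScalar.

Section CkCoordinates.
Context {R : realType} {V : normedModType R} {m n : nat}.
Implicit Types (f : V -> 'M[R]_(m, n)) (x v : V) (U : set V).

Lemma differentiable_mxP f x :
  differentiable f x <-> forall i j, differentiable (fun y => f y i j) x.
Proof.
split=> [fd i j|fd].
  exact: (@differentiable_comp _ _ _ _ f (fun N : 'M[R]_(m, n) => N i j) x fd
            (differentiable_coord _ _ _)).
have fE : f = \sum_(i < m) \sum_(j < n) (fun y => f y i j *: delta_mx i j).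
  apply/funext => y; rewrite [LHS]matrix_sum_delta fct_sumE.
  by apply: eq_bigr => i _; rewrite fct_sumE.
rewrite fE; apply: differentiable_sum => i; apply: differentiable_sum => j.
exact: differentiableZl.
Qed.

Lemma Ck_mxP k U f : open U ->
  Ck k U f <-> forall i j, Ck k U (fun x => f x i j : R).
Proof.
move=> oU; elim: k f => [|k IH] f.
  split=> [/= fc i j x Ux|/= fc x Ux].
    exact: (@continuous_comp _ _ _ f (fun N : 'M[R]_(m, n) => N i j : R) x
      (fc x Ux) (@coord_continuous _ _ _ i j _)).
  apply/cvg_ballP => e e0; near=> y; split=> // i j /=.
  move: i j; near: y; apply: filter_forall => i; apply: filter_forall => j.
  by have /cvg_ballP := fc i j x Ux; apply.
split=> [[fd fk] i j|fij]; split.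
- by move=> x Ux; have /differentiable_mxP := fd x Ux; apply.
- move=> v; have /IH/(_ i j) := fk v.
  apply: Ck_ext => // x; rewrite inE => Ux.
  by rewrite derive_mx ?mxE //; apply: diff_derivable; exact: fd.
- by move=> x Ux; apply/differentiable_mxP => i j; have [+ _] := fij i j; apply.
- move=> v; apply/IH => i j; have [_ /(_ v)] := fij i j.
  apply: Ck_ext => // x; rewrite inE => Ux.
  rewrite derive_mx ?mxE //; apply: diff_derivable.
  by apply/differentiable_mxP => i' j'; have [+ _] := fij i' j'; apply.
Unshelve. all: by end_near. Qed.

End CkCoordinates.

Section SmoothAt.
Context {R : realType} {V : normedModType R}.
Implicit Types (W : normedModType R) (x v : V) (U : set V).

Lemma smooth_at_ext W (f g : V -> W) x :
  (\forall y \near x, f y = g y) -> smooth_at f x -> smooth_at g x.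
Proof.
move=> fg [U [oU Ux fU]].
exists (U `&` [set y | f y = g y]^°); split.
- by apply: openI => //; exact: open_interior.
- by split.
- move=> k; apply: Ck_ext (Ck_sub (@subIsetl _ _ _) (fU k)).
    by apply: openI => //; exact: open_interior.
  by move=> y; rewrite inE => -[_ /interior_subset].
Qed.

Lemma smooth_at_near W (f : V -> W) x :
  smooth_at f x -> \forall y \near x, smooth_at f y.
Proof.
move=> [U [oU Ux fU]]; near=> y; exists U; split=> //.
near: y; exact: open_nbhs_nbhs.
Unshelve. all: by end_near. Qed.

Lemma smooth_at_differentiable W (f : V -> W) x :
  smooth_at f x -> differentiable f x.
Proof. by move=> [U [oU Ux fU]]; have [+ _] := fU 1%N; apply. Qed.

Lemma smooth_at_derive W (f : V -> W) v x :
  smooth_at f x -> smooth_at ('D_v f) x.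
Proof.
move=> [U [oU Ux fU]]; exists U; split=> // k.
by have [_ /(_ v)] := fU k.+1.
Qed.

Lemma smooth_at_cst W (w : W) x : smooth_at (fun=> w) x.
Proof. by exists setT; split=> // [|k]; [exact: openT|exact: Ck_cst]. Qed.

Lemma smooth_atD W (f g : V -> W) x :
  smooth_at f x -> smooth_at g x -> smooth_at (fun y => f y + g y) x.
Proof.
move=> [U [oU Ux fU]] [U' [oU' U'x gU]]; have oI := openI oU oU'.
exists (U `&` U'); split=> // k.
by apply: CkD => //; [exact: Ck_sub (fU k)|exact: Ck_sub (gU k)].
Qed.

Lemma smooth_atM (f g : V -> R) x :
  smooth_at f x -> smooth_at g x -> smooth_at (fun y => f y * g y) x.
Proof.
move=> [U [oU Ux fU]] [U' [oU' U'x gU]]; have oI := openI oU oU'.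
exists (U `&` U'); split=> // k.
by apply: CkM => //; [exact: Ck_sub (fU k)|exact: Ck_sub (gU k)].
Qed.

Lemma smooth_atV (f : V -> R) x :
  smooth_at f x -> f x != 0 -> smooth_at (fun y => (f y)^-1) x.
Proof.
move=> fx fx0; have [U [oU Ux fU]] := fx.
have fc : {for x, continuous f}.
  exact/differentiable_continuous/smooth_at_differentiable.
have f0 : \forall y \near x, f y != 0.
  near=> y; rewrite -normr_gt0.
  have : `|f x - f y| < `|f x|.
    near: y; move/cvgrPdist_lt : fc; apply; by rewrite normr_gt0.
  by case: (eqVneq (f y) 0) => [->|]; rewrite ?subr0 ?ltxx// normr_gt0.
have oI : open (U `&` [set y | f y != 0]^°).
  by apply: openI => //; exact: open_interior.
exists (U `&` [set y | f y != 0]^°); split=> //.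
move=> k; apply: (CkV oI) => [y [_ /interior_subset //]|].
exact: Ck_sub (fU k).
Unshelve. all: by end_near. Qed.

Lemma smooth_at_sum W I (r : seq I) (P : pred I) (F : I -> V -> W) x :
  (forall i, smooth_at (F i) x) -> smooth_at (fun y => \sum_(i <- r | P i) F i y) x.
Proof.
move=> Fx; elim: r => [|i r IH].
  by under eq_fun do rewrite big_nil; exact: smooth_at_cst.
under eq_fun do rewrite big_cons.
by case: (P i) => //; exact: smooth_atD.
Qed.

Lemma smooth_at_prod I (r : seq I) (P : pred I) (F : I -> V -> R) x :
  (forall i, smooth_at (F i) x) -> smooth_at (fun y => \prod_(i <- r | P i) F i y) x.
Proof.
move=> Fx; elim: r => [|i r IH].
  by under eq_fun do rewrite big_nil; exact: smooth_at_cst.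
under eq_fun do rewrite big_cons.
by case: (P i) => //; exact: smooth_atM.
Qed.

Lemma smooth_at_mxP m n (f : V -> 'M[R]_(m, n)) x :
  smooth_at f x <-> forall i j, smooth_at (fun y => f y i j : R) x.
Proof.
split=> [[U [oU Ux fU]] i j|fx].
  by exists U; split=> // k; have /(Ck_mxP _ _ oU) := fU k; apply.
(* Each entry is smooth on a neighbourhood of its own. There are finitely many entries, so the
   intersection is still a neighbourhood of [x], and its interior serves for all of them. *)
have {fx} [U HU] : {U : 'I_m * 'I_n -> set V | forall ij,
    [/\ open (U ij), U ij x & smooth_on (U ij) (fun y => f y ij.1 ij.2 : R)]}.
  by exists (fun ij => sval (cid (fx ij.1 ij.2))) => ij; case: cid.
have oI : open (\bigcap_ij U ij)^° by exact: open_interior.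
exists (\bigcap_ij U ij)^°; split=> //.
  have : \forall y \near x, forall ij, U ij y.
    apply: filter_forall => ij; have [oU Ux _] := HU ij.
    exact: open_nbhs_nbhs.
  by apply: filterS => y Uy ij _; exact: Uy.
move=> k; apply/Ck_mxP => // i j; have [_ _ /(_ k)] := HU (i, j).
by apply: Ck_sub => y /interior_subset; apply.
Qed.

Lemma smooth_at_det n (A : V -> 'M[R]_n) x :
  smooth_at A x -> smooth_at (fun y => \det (A y)) x.
Proof.
move=> /smooth_at_mxP Ax; apply: smooth_at_sum => s; apply: smooth_atM.
  exact: smooth_at_cst.
by apply: smooth_at_prod => i; exact: Ax.
Qed.

Lemma smooth_at_invmx n (A : V -> 'M[R]_n) x :
  smooth_at A x -> A x \in unitmx -> smooth_at (fun y => invmx (A y)) x.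
Proof.
move=> Ax uA; have /smooth_at_mxP Aij := Ax.
have d0 : \det (A x) != 0 by rewrite -unitfE.
have dA := smooth_at_det Ax.
have uAn : \forall y \near x, A y \in unitmx.
  have dc : {for x, continuous (fun y => \det (A y))}.
    exact/differentiable_continuous/smooth_at_differentiable.
  near=> y; rewrite unitmxE unitfE -normr_gt0.
  have : `|\det (A x) - \det (A y)| < `|\det (A x)|.
    near: y; move/cvgrPdist_lt : dc; apply; by rewrite normr_gt0.
  by case: (eqVneq (\det (A y)) 0) => [->|]; rewrite ?subr0 ?ltxx// normr_gt0.
(* Cramer's rule, available near [x], where the determinant does not vanish, reduces the inverse to
   determinants. *)
apply: (@smooth_at_ext _ (fun y => (\det (A y))^-1 *: \adj (A y))).
  by near=> y; have uAy : A y \in unitmx by [near: y]; rewrite /invmx uAy.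
apply/smooth_at_mxP => i j; under eq_fun do rewrite mxE.
apply: smooth_atM; first exact: smooth_atV.
under eq_fun do rewrite mxE; apply: smooth_atM; first exact: smooth_at_cst.
apply: smooth_at_det; apply/smooth_at_mxP => i' j'.
by under eq_fun do rewrite !mxE; exact: Aij.
Unshelve. all: by end_near. Qed.

End SmoothAt.

(** * Symmetry of second derivatives *)

Section Schwarz.
Context {R : realType} {V : normedModType R}.
Implicit Types (f : V -> R) (x u v : V).

Lemma is_derive_line f x u (s : R) : differentiable f (x + s *: u) ->
  is_derive s 1 (fun s : R => f (x + s *: u)) ('D_u f (x + s *: u)).
Proof.
move=> fd; set l := fun s : R => x + s *: u.
have ld : is_diff s l (fun t => t *: u).
  have -> : l = cst x + ( *:%R^~ u) by [].
  by apply: is_diff_eq; rewrite add0r.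
have dl : differentiable l s by exact: ex_diff.
have dfl : differentiable (f \o l) s by exact: differentiable_comp.
split; first exact: diff_derivable.
by rewrite deriveE // diff_comp //= diff_val scale1r -deriveE.
Qed.

(** The mean value theorem is used twice: in direction [u] for the difference [p] of [f] along two
    parallel segments, then in direction [v] for ['D_u f]. *)
Lemma second_difference_mvt f x u v (h : R) (h0 : 0 < h) :
  (forall s t, 0 <= s <= h -> 0 <= t <= h ->
     differentiable f (x + s *: u + t *: v)) ->
  (forall s t, 0 <= s <= h -> 0 <= t <= h ->
     differentiable ('D_u f) (x + s *: u + t *: v)) ->
  exists s t, [/\ 0 <= s <= h, 0 <= t <= h &
    f (x + h *: u + h *: v) - f (x + h *: u) - (f (x + h *: v) - f x) =
    h ^+ 2 * 'D_v ('D_u f) (x + s *: u + t *: v)].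
Proof.
move=> fd fdd; have hh : 0 <= h <= h by rewrite lexx ltW.
have h00 : 0 <= (0 : R) <= h by rewrite lexx ltW.
have swap a b c : x + a *: b + c = (x + c) + a *: b :> V by rewrite addrAC.
pose p (s : R) := f ((x + h *: v) + s *: u) - f (x + s *: u).
have dp (s : R) : 0 <= s <= h -> is_derive s 1 p
    ('D_u f ((x + h *: v) + s *: u) - 'D_u f (x + s *: u)).
  move=> sh; apply: is_deriveB; apply: is_derive_line.
    by rewrite -swap; exact: fd.
  by have := fd s 0 sh h00; rewrite scale0r addr0.
have pc (s : R) : 0 <= s <= h -> {for s, continuous p}.
  by move=> /dp d; apply/differentiable_continuous/derivable1_diffP.
have [||s sh Es] := MVT h0 (df := fun s => 'D_u f ((x + h *: v) + s *: u)
                        - 'D_u f (x + s *: u)) (f := p).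
- by move=> s; rewrite in_itv /= => /andP[/ltW s0 /ltW s1]; apply: dp; rewrite s0.
- apply: continuous_in_subspaceT => s; rewrite inE /= in_itv /=; exact: pc.
have {}sh : 0 <= s <= h by move: sh; rewrite in_itv /= => /andP[/ltW -> /ltW].
pose q (t : R) := 'D_u f ((x + s *: u) + t *: v).
have dq (t : R) : 0 <= t <= h -> is_derive t 1 q
    ('D_v ('D_u f) ((x + s *: u) + t *: v)).
  by move=> th; apply: is_derive_line; exact: fdd.
have qc (t : R) : 0 <= t <= h -> {for t, continuous q}.
  by move=> /dq d; apply/differentiable_continuous/derivable1_diffP.
have [||t th Et] := MVT h0
  (df := fun t => 'D_v ('D_u f) ((x + s *: u) + t *: v)) (f := q).
- by move=> t; rewrite in_itv /= => /andP[/ltW t0 /ltW t1]; apply: dq; rewrite t0.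
- apply: continuous_in_subspaceT => t; rewrite inE /= in_itv /=; exact: qc.
have {}th : 0 <= t <= h by move: th; rewrite in_itv /= => /andP[/ltW -> /ltW].
exists s, t; split=> //.
move: Es; rewrite /p scale0r !addr0 subr0 -[x + h *: v + s *: u]swap.
move: Et; rewrite /q scale0r addr0 subr0 => ->.
move=> E.
by rewrite [x + h *: u + _]swap E -mulrA -expr2 [LHS]mulrC.
Qed.

Lemma second_difference_lim f x u v (e : R) : smooth_at f x -> 0 < e ->
  exists2 d : R, 0 < d & forall h, 0 < h < d ->
    `|'D_v ('D_u f) x - h ^- 2 *
      (f (x + h *: u + h *: v) - f (x + h *: u) - (f (x + h *: v) - f x))| < e.
Proof.
move=> fx e0.
have dn : \forall y \near x, differentiable f y /\ differentiable ('D_u f) y.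
  have := smooth_at_near fx; apply: filterS => y fy.
  by split; apply: smooth_at_differentiable => //; exact: smooth_at_derive.
have cn : \forall y \near x, `|'D_v ('D_u f) x - 'D_v ('D_u f) y| < e.
  have /differentiable_continuous := smooth_at_differentiable
    (smooth_at_derive v (smooth_at_derive u fx)).
  by move/cvgrPdist_lt; apply.
have [r /= r0 rP] := (nbhs_ballP _ _).1 (filterI dn cn).
(* With [h * c < r] the whole parallelogram lies in the ball; the summand 1 keeps [c] positive when
   [u] and [v] vanish. *)
pose c := `|u| + `|v| + 1; have c0 : 0 < c by rewrite ltr_wpDl // addr_ge0.
exists (r / c); first exact: divr_gt0.
move=> h /andP[h0 hr].
have near_x s t : 0 <= s <= h -> 0 <= t <= h -> ball x r (x + s *: u + t *: v).
  move=> /andP[s0 sh] /andP[t0 th]; rewrite -ball_normE /= -addrA opprD addNKr.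
  rewrite normrN (le_lt_trans (ler_normD _ _)) // !normrZ !ger0_norm //.
  apply: (@le_lt_trans _ _ (h * c)); last by rewrite -ltr_pdivlMr.
  rewrite /c !mulrDr mulr1 -[leLHS]addr0.
  by rewrite lerD ?(ltW h0) // lerD // ler_wpM2r.
have [||s [t [sh th ->]]] := @second_difference_mvt f x u v h h0.
- by move=> s t sh th; have [[]] := rP _ (near_x s t sh th).
- by move=> s t sh th; have [[]] := rP _ (near_x s t sh th).
rewrite mulKf ?expf_neq0 ?gt_eqF //.
by have [] := rP _ (near_x s t sh th).
Qed.

(** Both iterated derivatives are limits of the same second difference quotient, which is symmetric
    in [u] and [v]. *)
Lemma schwarz f x u v : smooth_at f x ->
  'D_u ('D_v f) x = 'D_v ('D_u f) x.
Proof.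
move=> fx; apply/eqP; rewrite -subr_eq0 -normr_le0; apply/ler_addgt0Pl => e e0.
rewrite addr0; have e2 : 0 < e / 2 by exact: divr_gt0.
have [d1 d10 H1] := second_difference_lim u v fx e2.
have [d2 d20 H2] := second_difference_lim v u fx e2.
pose h := Num.min d1 d2 / 2.
have m0 : 0 < Num.min d1 d2 by rewrite lt_min d10.
have h0 : 0 < h by exact: divr_gt0.
have hm : h < Num.min d1 d2 by rewrite /h ltr_pdivrMr // ltr_pMr // ltr1n.
have /andP[hd1 hd2] : (h < d1) && (h < d2) by rewrite -lt_min.
have {}H1 := H1 h; rewrite h0 hd1 in H1; have {}H1 := H1 isT.
have {}H2 := H2 h; rewrite h0 hd2 in H2; have {}H2 := H2 isT.
set A := h ^- 2 * _ in H1; set B := h ^- 2 * _ in H2.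
have AB : A = B.
  by rewrite /A /B (addrAC x (h *: v)); congr (_ * _); ring.
rewrite -(subrKA B) (splitr e) (le_trans (ler_normD _ _)) // lerD ?ltW //.
by rewrite -AB distrC.
Qed.

End Schwarz.

(** * Calculus in charts *)

Lemma derive_comp (R : realType) (U V W : normedModType R) (f : U -> V)
    (g : V -> W) x v : differentiable f x -> differentiable g (f x) ->
  'D_v (g \o f) x = 'D_('D_v f x) g (f x).
Proof.
move=> fd gd; rewrite deriveE; last exact: differentiable_comp.
by rewrite diff_comp // (deriveE _ gd) (deriveE _ fd).
Qed.

Lemma schwarz_mx (R : realType) (V : normedModType R) m n
    (f : V -> 'M[R]_(m, n)) x u v : smooth_at f x ->
  'D_u ('D_v f) x = 'D_v ('D_u f) x.
Proof.
move=> fx; have fij i j := (smooth_at_mxP _ _).1 fx i j.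
have Dij w w' i j : ('D_w ('D_w' f) x) i j = 'D_w ('D_w' (fun y => f y i j : R)) x.
  rewrite derive_mx; last first.
    exact/diff_derivable/smooth_at_differentiable/smooth_at_derive.
  rewrite mxE; apply: near_eq_derive; near=> y.
  rewrite derive_mx ?mxE //; apply/diff_derivable/smooth_at_differentiable.
  by near: y; exact: smooth_at_near.
apply/matrixP => i j.
exact: (etrans (Dij u v i j) (etrans (schwarz u v (fij i j)) (esym (Dij v u i j)))).
Unshelve. all: by end_near. Qed.

Section Pairing.
Context {R : realType} {V : normedModType R} {n : nat}.
Implicit Types (L : V -> 'rV[R]_n -> R) (y : V -> 'rV[R]_n).

Lemma scalar_row_sum (l : 'rV[R]_n -> R) (v : 'rV[R]_n) : scalar l ->
  l v = \sum_(i < n) v 0 i * l (delta_mx 0 i).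
Proof.
move=> ls; pose lM := GRing.isLinear.Build _ _ _ _ l ls.
pose lL : {linear 'rV[R]_n -> R} := HB.pack l lM.
rewrite -[l]/(lL : _ -> _) [in LHS](row_sum_delta v) linear_sum.
by apply: eq_bigr => i _; rewrite linearZ.
Qed.

Lemma derive_linear (W : normedModType R) (f : V -> W) x : differentiable f x ->
  forall a u v, 'D_(a *: u + v) f x = a *: 'D_u f x + 'D_v f x.
Proof. by move=> fd a u v; rewrite !deriveE // linearP. Qed.

Variables (L : V -> 'rV[R]_n -> R) (y : V -> 'rV[R]_n) (x0 : V).
Hypothesis Ls : \forall x \near x0, scalar (L x).
Hypothesis Ld : forall i, differentiable (fun x => L x (delta_mx 0 i)) x0.
Hypothesis yd : differentiable y x0.

Let yid i : differentiable (fun x => y x 0 i : R) x0.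
Proof. by have /differentiable_mxP := yd; apply. Qed.

Let nearE (z : V -> 'rV[R]_n) : \forall x \near x0,
  (\sum_(i < n) (fun t => z t 0 i * L t (delta_mx 0 i))) x = L x (z x).
Proof.
by apply: filterS Ls => x Lx; rewrite fct_sumE [RHS]scalar_row_sum.
Qed.

Lemma differentiable_pairing : differentiable (fun x => L x (y x)) x0.
Proof.
apply: near_eq_differentiable (nearE y) _.
by apply: differentiable_sum => i; apply: differentiableM.
Qed.

(** In coordinates this is the product rule for the sum of the [y_i L_i]. The first term freezes the
    vector at [x0], the second freezes the form. Linearity is asked only near [x0], because chart
    expressions of forms are linear only on the image of the chart. *)
Lemma derive_pairing u :
  'D_u (fun x => L x (y x)) x0 =
  'D_u (fun x => L x (y x0)) x0 + L x0 ('D_u y x0).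
Proof.
have Lid i : derivable (fun x => L x (delta_mx 0 i)) x0 u by exact: diff_derivable.
have yiv i : derivable (fun x => y x 0 i : R) x0 u by exact: diff_derivable.
have yc i : derivable (fun=> y x0 0 i : R) x0 u by exact: derivable_cst.
rewrite -(near_eq_derive u (nearE y)) -(near_eq_derive u (nearE (fun=> y x0))).
rewrite !derive_sum; last 2 first.
- by move=> i; apply: derivableM.
- by move=> i; apply: derivableM.
rewrite (scalar_row_sum _ (nbhs_singleton Ls)) -big_split /=.
apply: eq_bigr => i _.
rewrite [LHS]deriveM // [X in _ = X + _]deriveM //.
rewrite derive_cst scaler0 addr0; congr (_ + _).
by rewrite derive_mx ?mxE /GRing.scale /= 1?mulrC//; exact: diff_derivable.
Qed.

End Pairing.

Section Charts.
Context {R : realType} {n : nat} {M : manifold R n}.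
Implicit Types (p q r : M) (W : normedModType R).

Lemma chart_dom_near p q : chart_dom p q -> \forall r \near q, chart_dom p r.
Proof. by move=> pq; apply: open_nbhs_nbhs; split; [exact: chart_dom_open|]. Qed.

Lemma chart_img_near p q : chart_dom p q ->
  \forall x \near chart p q, (chart p @` chart_dom p) x.
Proof.
move=> pq; apply: open_nbhs_nbhs; split; first exact: chart_img_open.
by exists q.
Qed.

Lemma chart_img_dom p x : (chart p @` chart_dom p) x -> chart_dom p (chart_inv p x).
Proof. by move=> [q pq <-]; rewrite chartK. Qed.

Lemma chart_invK p x : (chart p @` chart_dom p) x -> chart p (chart_inv p x) = x.
Proof. by move=> [q pq <-]; rewrite chartK. Qed.

Lemma chart_inv_near p r (P : set M) : chart_dom p r -> (\forall s \near r, P s) ->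
  \forall x \near chart p r, P (chart_inv p x).
Proof.
move=> pr Pr; have : {for chart p r, continuous (chart_inv p)}.
  by apply: chart_inv_continuous; exists r.
by rewrite /prop_for /continuous_at chartK //; apply.
Qed.

Lemma chart_transition_smooth p q r : chart_dom p r -> chart_dom q r ->
  smooth_at (chart q \o chart_inv p) (chart p r).
Proof.
move=> pr qr; exists (chart p @` (chart_dom p `&` chart_dom q))^°; split.
- exact: open_interior.
- near=> x.
  have px : (chart p @` chart_dom p) x by near: x; exact: chart_img_near.
  exists (chart_inv p x); last exact: chart_invK.
  split; first exact: chart_img_dom.
  by near: x; apply: chart_inv_near => //; exact: chart_dom_near.
- by move=> k; apply: Ck_sub (@chart_transition _ _ M p q k); exact: interior_subset.
Unshelve. all: by end_near. Qed.

Lemma chart_transition_differentiable p q r : chart_dom p r -> chart_dom q r ->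
  differentiable (chart q \o chart_inv p) (chart p r).
Proof. by move=> pr qr; exact/smooth_at_differentiable/chart_transition_smooth. Qed.

Lemma chart_changeE W (f : M -> W) p q r : chart_dom p r -> chart_dom q r ->
  \forall x \near chart q r,
    ((f \o chart_inv p) \o (chart p \o chart_inv q)) x = (f \o chart_inv q) x.
Proof.
move=> pr qr; near=> x => /=; rewrite chartK //.
by near: x; apply: chart_inv_near => //; exact: chart_dom_near.
Unshelve. all: by end_near. Qed.

Lemma differentiable_chart_change W (f : M -> W) p q r :
  chart_dom p r -> chart_dom q r ->
  differentiable (f \o chart_inv p) (chart p r) ->
  differentiable (f \o chart_inv q) (chart q r).
Proof.
move=> pr qr fd; apply: near_eq_differentiable (chart_changeE f pr qr) _.
apply: differentiable_comp; first exact: chart_transition_differentiable.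
by rewrite /= chartK.
Qed.

Lemma derive_chart_change W (f : M -> W) p q r v :
  chart_dom p r -> chart_dom q r ->
  differentiable (f \o chart_inv p) (chart p r) ->
  'D_v (f \o chart_inv q) (chart q r) =
  'D_('D_v (chart p \o chart_inv q) (chart q r)) (f \o chart_inv p) (chart p r).
Proof.
move=> pr qr fd; rewrite -(near_eq_derive v (chart_changeE f pr qr)).
have td := chart_transition_differentiable qr pr.
have E : (chart p \o chart_inv q) (chart q r) = chart p r by rewrite /= chartK.
have fd' : differentiable (f \o chart_inv p) ((chart p \o chart_inv q) (chart q r)).
  by rewrite E.
by rewrite (derive_comp v td fd') E.
Qed.

Lemma derive_chart_id p r v : chart_dom p r ->
  'D_v (chart p \o chart_inv p) (chart p r) = v.
Proof.
move=> pr; rewrite -[RHS](@derive_id _ _ (chart p r) v).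
by apply: near_eq_derive; apply: filterS (chart_img_near pr) => x /chart_invK.
Qed.

(** The two transition maps are inverse to each other, hence so are their differentials; every
    tangent vector is thus reached from any chart around its base point. *)
Lemma derive_chartK p q r v : chart_dom p r -> chart_dom q r ->
  'D_('D_v (chart p \o chart_inv q) (chart q r)) (chart q \o chart_inv p) (chart p r)
  = v.
Proof.
move=> pr qr; rewrite -derive_chart_change ?derive_chart_id //.
exact: chart_transition_differentiable.
Qed.

Lemma smooth_fun_differentiable W (f : M -> W) p r : smooth_fun f -> chart_dom p r ->
  differentiable (f \o chart_inv p) (chart p r).
Proof.
move=> fs pr; apply: (@differentiable_chart_change _ _ r) => //.
  exact: chart_dom_mem.
exact: smooth_at_differentiable (fs r).
Qed.

(** A derivative at [r] is defined in the chart at [r], while differentiating again at [p] needs it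
    at all points [r] near [p] in the one chart at [p]. *)
Lemma ddir_chart W (f : M -> W) p r v : chart_dom p r ->
  differentiable (f \o chart_inv p) (chart p r) ->
  ddir f r v = 'D_(ddir (chart p) r v) (f \o chart_inv p) (chart p r).
Proof. by move=> pr fd; apply: derive_chart_change => //; exact: chart_dom_mem. Qed.

End Charts.

Section LocalExpressions.
Context {R : realType} {n : nat} {M : manifold R n}.
Implicit Types (p q r : M) (X Y Z : vfield M) (w : oneform M) (f h : M -> R).

(** The vector [X q] is written in the chart at [q], which changes with [q]; this converts it to the
    fixed chart at [p]. The next definition does the same for a 1-form, in the shape used by
    [smooth_oneform]. *)
Definition vfield_chart p X (x : 'rV[R]_n) : 'rV[R]_n :=
  ddir (chart p) (chart_inv p x) (X (chart_inv p x)).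

Definition oneform_chart p w (x v : 'rV[R]_n) : R :=
  w (chart_inv p x) ('D_v (chart (chart_inv p x) \o chart_inv p) x).

Definition smooth_vfield_chart X p : smooth_vfield X ->
  smooth_at (vfield_chart p X) (chart p p) := fun Xs => Xs p.

Lemma vfield_chart_center X p : vfield_chart p X (chart p p) = X p.
Proof.
have pp := chart_dom_mem p.
by rewrite /vfield_chart chartK // /ddir derive_chart_id.
Qed.

Lemma chart_near_center p : \forall x \near chart p p,
  (chart p @` chart_dom p) x.
Proof. exact/chart_img_near/chart_dom_mem. Qed.

Lemma Xderiv_chart X f p x : (chart p @` chart_dom p) x -> smooth_fun f ->
  Xderiv X f (chart_inv p x) = 'D_(vfield_chart p X x) (f \o chart_inv p) x.
Proof.
move=> px fs; have pr := chart_img_dom px.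
rewrite /Xderiv (ddir_chart _ pr) ?chart_invK //.
by have := smooth_fun_differentiable fs pr; rewrite chart_invK.
Qed.

Lemma oneform_app_chart w X p x : (chart p @` chart_dom p) x ->
  oneform_app w X (chart_inv p x) = oneform_chart p w x (vfield_chart p X x).
Proof.
move=> px; have pr := chart_img_dom px; have rr := chart_dom_mem (chart_inv p x).
rewrite /oneform_app /oneform_chart /vfield_chart /ddir.
by have := derive_chartK (X (chart_inv p x)) pr rr; rewrite chart_invK // => ->.
Qed.

Lemma oneform_chart_center w p v : oneform_chart p w (chart p p) v = w p v.
Proof.
have pp := chart_dom_mem p.
by rewrite /oneform_chart chartK // derive_chart_id.
Qed.

Lemma oneform_chart_scalar w p x : (forall q, scalar (w q)) ->
  (chart p @` chart_dom p) x -> scalar (oneform_chart p w x).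
Proof.
move=> ws px a u v; rewrite /oneform_chart derive_linear ?ws //.
have pr := chart_img_dom px; have rr := chart_dom_mem (chart_inv p x).
by have := chart_transition_differentiable pr rr; rewrite chart_invK.
Qed.

Lemma smooth_Xderiv X f : smooth_vfield X -> smooth_fun f -> smooth_fun (Xderiv X f).
Proof.
move=> Xs fs p; set F := f \o chart_inv p.
apply: (@smooth_at_ext _ _ _
  (fun x => \sum_(i < n) vfield_chart p X x 0 i * 'D_(delta_mx 0 i) F x)).
  near=> x.
  have px : (chart p @` chart_dom p) x by near: x; exact: chart_near_center.
  rewrite /= Xderiv_chart // [RHS](@scalar_row_sum _ _ (fun v => 'D_v F x)) //.
  apply: derive_linear; apply: smooth_at_differentiable.
  by near: x; exact: smooth_at_near (fs p).
apply: smooth_at_sum => i; apply: smooth_atM.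
  by have /smooth_at_mxP := smooth_vfield_chart p Xs; apply.
exact: smooth_at_derive (fs p).
Unshelve. all: by end_near. Qed.

(** A second derivative splits into a Hessian term and a derivative of the components of the inner
    field. The Hessian terms cancel by [schwarz], and the others form the derivative along the
    bracket. *)
Lemma Xderiv_bracket X Y f p :
  smooth_vfield X -> smooth_vfield Y -> smooth_fun f ->
  Xderiv (lie_bracket X Y) f p =
  Xderiv X (Xderiv Y f) p - Xderiv Y (Xderiv X f) p.
Proof.
move=> Xs Ys fs; set F := f \o chart_inv p.
have Fs : smooth_at F (chart p p) := fs p.
have XY (U Z : vfield M) : smooth_vfield Z ->
    Xderiv U (Xderiv Z f) p = 'D_(U p) (fun x => 'D_(Z p) F x) (chart p p) +
                'D_('D_(U p) (vfield_chart p Z) (chart p p)) F (chart p p).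
  move=> Zs; rewrite -(vfield_chart_center Z p).
  rewrite -(@derive_pairing _ _ _ (fun x v => 'D_v F x) (vfield_chart p Z)).
  - apply: near_eq_derive; near=> x => /=; apply: Xderiv_chart => //.
    by near: x; exact: chart_near_center.
  - near=> x; apply: derive_linear; apply: smooth_at_differentiable.
    by near: x; exact: smooth_at_near Fs.
  - by move=> i; apply: smooth_at_differentiable; exact: smooth_at_derive.
  - exact: smooth_at_differentiable (smooth_vfield_chart p Zs).
rewrite XY // XY // (schwarz (Y p) (X p) Fs) opprD addrACA subrr add0r.
have Fd := smooth_at_differentiable Fs.
have lb : lie_bracket X Y p = (-1) *: 'D_(Y p) (vfield_chart p X) (chart p p) +
    'D_(X p) (vfield_chart p Y) (chart p p) by rewrite scaleN1r addrC.
by rewrite /Xderiv /ddir lb derive_linear // scaleN1r addrC.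
Unshelve. all: by end_near. Qed.

(** The exterior derivative as a form on tangent vectors: [u] and [v] are extended as constant
    fields of the chart at [p], whose bracket vanishes. *)
Definition dform w p (u v : 'rV[R]_n) : R :=
  'D_u (fun x => oneform_chart p w x v) (chart p p) -
  'D_v (fun x => oneform_chart p w x u) (chart p p).

(** The derivatives of the components of [X] and [Y], paired with [w p], are exactly the bracket
    term, so only the values of the fields at [p] survive. *)
Lemma d1E w X Y p : (forall q, scalar (w q)) ->
  (forall v, differentiable (fun x => oneform_chart p w x v) (chart p p)) ->
  smooth_vfield X -> smooth_vfield Y ->
  d1 w X Y p = dform w p (X p) (Y p).
Proof.
move=> ws wd Xs Ys.
have XY (U Z : vfield M) : smooth_vfield Z ->
    Xderiv U (oneform_app w Z) p =
    'D_(U p) (fun x => oneform_chart p w x (Z p)) (chart p p) +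
    w p ('D_(U p) (vfield_chart p Z) (chart p p)).
  move=> Zs; rewrite -(oneform_chart_center w p) -{1}(vfield_chart_center Z p).
  rewrite -(@derive_pairing _ _ _ (oneform_chart p w) (vfield_chart p Z)).
  - apply: near_eq_derive; near=> x => /=; apply: oneform_app_chart.
    by near: x; exact: chart_near_center.
  - near=> x; apply: oneform_chart_scalar => //.
    by near: x; exact: chart_near_center.
  - by move=> i; exact: wd.
  - exact: smooth_at_differentiable (smooth_vfield_chart p Zs).
have wB a b : w p (a - b) = w p a - w p b.
  by rewrite -scaleN1r addrC ws mulN1r addrC.
have -> : d1 w X Y p = Xderiv X (oneform_app w Y) p -
    Xderiv Y (oneform_app w X) p - w p ('D_(X p) (vfield_chart p Y) (chart p p)
      - 'D_(Y p) (vfield_chart p X) (chart p p)) by [].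
(* Proved for arbitrary reals: comparing distinct derivatives up to conversion,
   as [ring] would do, does not terminate in practice.  The auxiliary facts
   [cancel] and [solve] below have the same reason. *)
rewrite (XY X Y Ys) (XY Y X Xs) wB /dform.
have cancel (a b c d : R) : a + c - (b + d) - (c - d) = a - b by ring.
exact: cancel.
Unshelve. all: by end_near. Qed.

End LocalExpressions.

(** * Pullbacks and left invariant frames *)

Section Pullback.
Context {R : realType} {m n : nat} {M : manifold R m} {N : manifold R n}.
Variables (f : M -> N) (w : oneform N).
Hypothesis fs : smooth_map f.
Hypothesis ws : smooth_oneform w.

Let fhat (p : M) : 'rV[R]_m -> 'rV[R]_n := chart (f p) \o f \o chart_inv p.

Let fhat_smooth p : smooth_at (fhat p) (chart p p).
Proof. exact: fs.2. Qed.

Let f_near p r : chart_dom (f p) (f r) -> \forall s \near r, chart_dom (f p) (f s).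
Proof. by move=> pr; apply: (fs.1 r); exact: chart_dom_near. Qed.

Lemma oneform_chart_pullback p v : \forall x \near chart p p,
  oneform_chart p (pullback f w) x v =
  oneform_chart (f p) w (fhat p x) ('D_v (fhat p) x).
Proof.
have pp := chart_dom_mem p; have fpp := chart_dom_mem (f p).
near=> x.
have px : (chart p @` chart_dom p) x by near: x; exact: chart_near_center.
have dx : differentiable (fhat p) x.
  apply: smooth_at_differentiable; near: x.
  exact: smooth_at_near (fhat_smooth p).
have pr : chart_dom (f p) (f (chart_inv p x)).
  by near: x; exact: (chart_inv_near pp (f_near fpp)).
move: px pr dx => [r pr <-]; rewrite /oneform_chart /pullback (chartK pr) => fpr dx.
have E : fhat p (chart p r) = chart (f p) (f r) by rewrite /fhat /= (chartK pr).
rewrite E (chartK fpr); apply: (congr1 (w (f r))).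
have rr := chart_dom_mem r; have frr := chart_dom_mem (f r).
have dr := smooth_at_differentiable (fhat_smooth r).
rewrite /dmap /ddir -(derive_chart_change v rr pr dr).
have td : differentiable (chart (f r) \o chart_inv (f p)) (fhat p (chart p r)).
  by rewrite E; exact: chart_transition_differentiable.
have -> : 'D_v ((chart (f r) \o f) \o chart_inv p) (chart p r) =
  'D_v ((chart (f r) \o chart_inv (f p)) \o fhat p) (chart p r).
  apply: near_eq_derive; near=> y; rewrite /= chartK //.
  by near: y; exact: (chart_inv_near pr (f_near fpr)).
by rewrite (derive_comp v dx td) E.
Unshelve. all: by end_near. Qed.

Let L p x u : R := oneform_chart (f p) w (fhat p x) u.

Let L_scalar p : \forall x \near chart p p, scalar (L p x).
Proof.
have pp := chart_dom_mem p; have fpp := chart_dom_mem (f p).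
near=> x; apply: oneform_chart_scalar; first exact: ws.1.
exists (f (chart_inv p x)) => //.
by near: x; exact: (chart_inv_near pp (f_near fpp)).
Unshelve. all: by end_near. Qed.

Let fhat_center p : fhat p (chart p p) = chart (f p) (f p).
Proof. by rewrite /fhat /= chartK //; exact: chart_dom_mem. Qed.

Let w_differentiable p u :
  differentiable (fun y => oneform_chart (f p) w y u) (fhat p (chart p p)).
Proof. by rewrite fhat_center; apply: smooth_at_differentiable; exact: ws.2. Qed.

Let fhat_differentiable p : differentiable (fhat p) (chart p p).
Proof. exact: smooth_at_differentiable. Qed.

Let L_differentiable p u : differentiable (fun x => L p x u) (chart p p).
Proof.
exact: (@differentiable_comp _ _ _ _ _ (fun y => oneform_chart (f p) w y u)).
Qed.

Let dfhat_differentiable p v : differentiable ('D_v (fhat p)) (chart p p).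
Proof. exact: smooth_at_differentiable (smooth_at_derive v (fhat_smooth p)). Qed.

Lemma pullback_scalar p : scalar (pullback f w p).
Proof.
move=> a u v; rewrite /pullback -ws.1; congr (w _ _).
exact: derive_linear (fhat_differentiable p) _ _ _.
Qed.

Lemma pullback_differentiable p v :
  differentiable (fun x => oneform_chart p (pullback f w) x v) (chart p p).
Proof.
apply: (@near_eq_differentiable _ _ _ (fun x => L p x ('D_v (fhat p) x))).
  by apply: filterS (oneform_chart_pullback p v) => x ->.
exact: differentiable_pairing.
Qed.

(** Differentiating the pullback produces a second derivative of [fhat p]. It is symmetric by
    [schwarz_mx] and disappears under antisymmetrisation. *)
Lemma dform_pullback p u v :
  dform (pullback f w) p u v = dform w (f p) (dmap f p u) (dmap f p v).
Proof.
have DE a b : 'D_a (fun x => oneform_chart p (pullback f w) x b) (chart p p) =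
    'D_(dmap f p a) (fun y => oneform_chart (f p) w y (dmap f p b))
      (chart (f p) (f p)) + L p (chart p p) ('D_a ('D_b (fhat p)) (chart p p)).
  pose g y := oneform_chart (f p) w y ('D_b (fhat p) (chart p p)).
  have gd : differentiable g (fhat p (chart p p)) by exact: w_differentiable.
  have gE : 'D_a (fun x => L p x ('D_b (fhat p) (chart p p))) (chart p p) =
            'D_('D_a (fhat p) (chart p p)) g (fhat p (chart p p)).
    exact: (derive_comp a (fhat_differentiable p) gd).
  rewrite (near_eq_derive a (oneform_chart_pullback p b)).
  rewrite (derive_pairing (L_scalar p) (fun i => L_differentiable p _)
             (dfhat_differentiable p b) a) gE.
  by rewrite /g fhat_center.
have cancel (a b c d : R) : c = d -> a + c - (b + d) = a - b by move=> ->; ring.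
apply: (etrans (f_equal2 (fun a b => a - b) (DE u v) (DE v u))).
have S := congr1 (L p (chart p p)) (schwarz_mx u v (fhat_smooth p)).
exact: (cancel _ _ _ _ S).
Qed.

(** The fields are related at the single point [p], which suffices because [d1E] makes both sides
    tensorial. *)
Lemma d1_pullback (X Y : vfield M) (X' Y' : vfield N) p :
  smooth_vfield X -> smooth_vfield Y -> smooth_vfield X' -> smooth_vfield Y' ->
  X' (f p) = dmap f p (X p) -> Y' (f p) = dmap f p (Y p) ->
  d1 (pullback f w) X Y p = d1 w X' Y' (f p).
Proof.
move=> Xs Ys X's Y's EX EY.
rewrite d1E //; last 2 first.
- exact: pullback_scalar.
- exact: pullback_differentiable.
rewrite dform_pullback -EX -EY d1E //; first exact: ws.1.
by move=> v; apply: smooth_at_differentiable; exact: ws.2.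
Qed.

End Pullback.

Lemma lg_mul_transitive (R : realType) n (G : lieGroup R n) (p q : G) :
  exists h, lg_mul h p = q.
Proof.
(* The group axioms give left inverses only; the right inverse comes from multiplying by the left
   inverse of [lg_inv x]. *)
have mulgV (x : G) : lg_mul x (lg_inv x) = lg_one G.
  rewrite -[LHS]lg_mul1 -{1}(lg_mulV (lg_inv x)) -lg_mulA (lg_mulA (lg_inv x)).
  by rewrite lg_mulV lg_mul1 lg_mulV.
exists (lg_mul q (lg_inv p)).
have mulg1 (x : G) : lg_mul x (lg_one G) = x.
  by rewrite -(lg_mulV x) lg_mulA mulgV lg_mul1.
by rewrite -lg_mulA lg_mulV mulg1.
Qed.

Section LeftInvariantFrame.
Context {R : realType} {n : nat} {G : lieGroup R n} {s : n.-tuple (oneform G)}.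
Hypothesis sB : left_invariant_basis s.

Let s_smooth i : smooth_oneform (tnth s i). Proof. exact: (sB.1 i).1. Qed.

(** A left translation carries a linear relation at [q] to every other point, so it is a relation
    between the forms on all of G. Uniqueness of the coefficients of the zero form then makes it
    trivial. *)
Lemma left_invariant_basis_free (q : G) (c : 'rV[R]_n) :
  (forall v, \sum_(i < n) c 0 i * tnth s i q v = 0) -> c = 0.
Proof.
move=> c0; have zero_li : left_invariant ((fun _ _ => 0) : oneform G).
  split=> //; split=> [p a u v|p v]; first by rewrite mulr0 addr0.
  exact: smooth_at_cst.
have [c' [_ c'U]] := sB.2 _ zero_li.
have <- : c' = 0.
  by apply: c'U => q' v; rewrite big1 // => i _; rewrite mxE mul0r.
apply/esym/c'U => q' v.
have [h hq] := lg_mul_transitive q' q.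
rewrite -hq in c0; rewrite -[LHS](c0 (dmap (lg_mul h) q' v)).
apply: eq_bigr => i _.
exact: (congr1 (fun z => c 0 i * z) ((sB.1 i).2 h q' v)).
Qed.

Definition frame_matrix p (x : 'rV[R]_n) : 'M[R]_n :=
  \matrix_(j, i) oneform_chart p (tnth s i) x (delta_mx 0 j).

Lemma mul_frame_matrix p x v i : (chart p @` chart_dom p) x ->
  (v *m frame_matrix p x) 0 i = oneform_chart p (tnth s i) x v.
Proof.
move=> px; rewrite mxE [RHS]scalar_row_sum; last first.
  by apply: oneform_chart_scalar => // q; exact: (s_smooth i).1.
by apply: eq_bigr => j _; rewrite mxE.
Qed.

Lemma frame_matrix_unit p x : (chart p @` chart_dom p) x ->
  frame_matrix p x \in unitmx.
Proof.
(* On the transpose, a row [c] of the kernel is a linear relation between the forms at the point of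
   coordinates [x]. *)
move=> px; rewrite -unitmx_tr -row_free_unit; apply: inj_row_free => c c0.
have [q pq qx] := px; have qq := chart_dom_mem q.
apply: (@left_invariant_basis_free q) => v.
have <- := derive_chartK v pq qq.
set v' := 'D_v _ _; rewrite qx.
transitivity ((v' *m frame_matrix p x *m c^T) 0 0).
  rewrite [RHS]mxE; apply: eq_bigr => i _.
  by rewrite mul_frame_matrix // mxE /oneform_chart -qx chartK // mulrC.
by rewrite -mulmxA -[X in _ *m X]trmxK trmx_mul trmxK c0 trmx0 mulmx0 mxE.
Qed.

(** The combination, with constant coefficients [a], of the fields dual to [s]. *)
Definition frame_vfield (a : 'rV[R]_n) : vfield G :=
  fun q => a *m invmx (frame_matrix q (chart q q)).

Lemma frame_vfieldE a i q : tnth s i q (frame_vfield a q) = a 0 i.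
Proof.
have qq : (chart q @` chart_dom q) (chart q q) by exists q => //; exact: chart_dom_mem.
rewrite -oneform_chart_center -mul_frame_matrix // mulmxKV //.
exact: frame_matrix_unit.
Qed.

Lemma frame_vfield_smooth a : smooth_vfield (frame_vfield a).
Proof.
move=> p; have pp := chart_dom_mem p.
have img : \forall x \near chart p p, (chart p @` chart_dom p) x.
  exact: chart_near_center.
(* The definition inverts a matrix in a different chart at each point. The values of the forms on
   the field determine it, so in the fixed chart at [p] it solves the same linear system, whose
   matrix is smooth. *)
apply: (@smooth_at_ext _ _ _ (fun x => a *m invmx (frame_matrix p x))).
  apply: filterS img => x px; rewrite -[RHS]/(vfield_chart p (frame_vfield a) x).
  apply: (canLR (mulmxK (frame_matrix_unit px))).
  apply/rowP => i; rewrite mul_frame_matrix // -oneform_app_chart //.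
  by rewrite /oneform_app frame_vfieldE.
have Fs : smooth_at (frame_matrix p) (chart p p).
  apply/smooth_at_mxP => j i; under eq_fun do rewrite mxE.
  exact: (s_smooth i).2.
apply/smooth_at_mxP => k i; under eq_fun do rewrite mxE.
apply: smooth_at_sum => j; apply: smooth_atM; first exact: smooth_at_cst.
have Iu := smooth_at_invmx Fs (frame_matrix_unit (nbhs_singleton img)).
by have /smooth_at_mxP := Iu; apply.
Qed.

Lemma exists_smooth_vfield (q : G) (v : 'rV[R]_n) :
  exists X : vfield G, smooth_vfield X /\ X q = v.
Proof.
have qq : (chart q @` chart_dom q) (chart q q) by exists q => //; exact: chart_dom_mem.
exists (frame_vfield (v *m frame_matrix q (chart q q))); split.
  exact: frame_vfield_smooth.
by rewrite /frame_vfield mulmxK //; exact: frame_matrix_unit.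
Qed.

Lemma pullback_structure_equation m (M : manifold R m) (f : M -> G)
    (w : oneform G) (b : twotensor G) (c : twotensor M) :
  smooth_map f -> smooth_oneform w -> eq_two (d1 w) b ->
  (forall X Y X' Y' p, X' (f p) = dmap f p (X p) -> Y' (f p) = dmap f p (Y p) ->
     b X' Y' (f p) = c X Y p) ->
  eq_two (d1 (pullback f w)) c.
Proof.
move=> fs ws wb bc X Y Xs Ys p.
have [X' [X's EX]] := exists_smooth_vfield (f p) (dmap f p (X p)).
have [Y' [Y's EY]] := exists_smooth_vfield (f p) (dmap f p (Y p)).
by rewrite (d1_pullback fs ws Xs Ys X's Y's EX EY) wb // (bc X Y).
Qed.

End LeftInvariantFrame.

(** * Functions, vector fields, metrics and forms on a manifold *)

Section FunctionsAndFields.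
Context {R : realType} {n : nat} {M : manifold R n}.
Implicit Types (p : M) (X Y Z : vfield M) (f h : M -> R).

Lemma smooth_fun_cst (a : R) : smooth_fun (fun _ : M => a).
Proof. by move=> p; exact: smooth_at_cst. Qed.

Lemma smooth_funD f h : smooth_fun f -> smooth_fun h ->
  smooth_fun (fun q => f q + h q).
Proof. by move=> fs hs p; exact: smooth_atD (fs p) (hs p). Qed.

Lemma smooth_funM f h : smooth_fun f -> smooth_fun h ->
  smooth_fun (fun q => f q * h q).
Proof. by move=> fs hs p; exact: smooth_atM (fs p) (hs p). Qed.

Lemma smooth_funN f : smooth_fun f -> smooth_fun (fun q => - f q).
Proof.
move=> fs; have -> : (fun q => - f q) = (fun q => -1 * f q).
  by apply/funext => q; rewrite mulN1r.
exact: smooth_funM (smooth_fun_cst _) fs.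
Qed.

Lemma smooth_funB f h : smooth_fun f -> smooth_fun h ->
  smooth_fun (fun q => f q - h q).
Proof. by move=> fs hs; apply: smooth_funD => //; exact: smooth_funN. Qed.

Let derivable_fun f p v : smooth_fun f ->
  derivable (f \o chart_inv p) (chart p p) v.
Proof. by move=> fs; apply/diff_derivable/smooth_at_differentiable; exact: fs. Qed.

Lemma Xderiv_cst X (a : R) p : Xderiv X (fun=> a) p = 0.
Proof. exact: derive_cst. Qed.

Lemma XderivD X f h p : smooth_fun f -> smooth_fun h ->
  Xderiv X (fun q => f q + h q) p = Xderiv X f p + Xderiv X h p.
Proof. by move=> fs hs; exact: deriveD (derivable_fun fs) (derivable_fun hs). Qed.

Lemma XderivN X f p : smooth_fun f -> Xderiv X (fun q => - f q) p = - Xderiv X f p.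
Proof. by move=> fs; exact: deriveN (derivable_fun fs). Qed.

Lemma XderivB X f h p : smooth_fun f -> smooth_fun h ->
  Xderiv X (fun q => f q - h q) p = Xderiv X f p - Xderiv X h p.
Proof. by move=> fs hs; exact: deriveB (derivable_fun fs) (derivable_fun hs). Qed.

Lemma XderivM X f h p : smooth_fun f -> smooth_fun h ->
  Xderiv X (fun q => f q * h q) p = Xderiv X f p * h p + f p * Xderiv X h p.
Proof.
move=> fs hs.
have fE : (f \o chart_inv p) (chart p p) = f p.
  by rewrite /= chartK //; exact: chart_dom_mem.
have hE : (h \o chart_inv p) (chart p p) = h p.
  by rewrite /= chartK //; exact: chart_dom_mem.
have E : Xderiv X (fun q => f q * h q) p =
    (f \o chart_inv p) (chart p p) *: Xderiv X h p +
    (h \o chart_inv p) (chart p p) *: Xderiv X f p.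
  exact: deriveM (derivable_fun fs) (derivable_fun hs).
by rewrite E fE hE addrC mulrC.
Qed.

Lemma smooth_vfieldZD f X Y : smooth_fun f -> smooth_vfield X -> smooth_vfield Y ->
  smooth_vfield (fun q => f q *: X q + Y q).
Proof.
move=> fs Xs Ys p.
apply: (@smooth_at_ext _ _ _ (fun x => f (chart_inv p x) *: vfield_chart p X x +
                                     vfield_chart p Y x)).
  apply: filterS (chart_near_center p) => x px.
  have pr := chart_img_dom px; have rr := chart_dom_mem (chart_inv p x).
  exact/esym/(derive_linear (chart_transition_differentiable rr pr)).
apply: smooth_atD; last exact: Ys.
have /smooth_at_mxP Xij := Xs p.
apply/smooth_at_mxP => i j; under eq_fun do rewrite mxE.
exact: smooth_atM (fs p) (Xij i j).
Qed.

Lemma smooth_vfield0 : smooth_vfield (fun _ : M => 0 : 'rV[R]_n).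
Proof.
move=> p; apply: (@smooth_at_ext _ _ _ (fun=> 0)); last exact: smooth_at_cst.
by near=> x; apply/esym; exact: derive0.
Unshelve. all: by end_near. Qed.

Lemma smooth_vfield_sum (I : Type) (r : seq I) (c : I -> M -> R) (E : I -> vfield M) :
  (forall i, smooth_fun (c i)) -> (forall i, smooth_vfield (E i)) ->
  smooth_vfield (fun q => \sum_(i <- r) c i q *: E i q).
Proof.
move=> cs Es; elim: r => [|i r IH].
  have -> : (fun q => \sum_(i <- [::]) c i q *: E i q) = (fun=> 0).
    by apply/funext => q; rewrite big_nil.
  exact: smooth_vfield0.
have -> : (fun q => \sum_(j <- i :: r) c j q *: E j q) =
    (fun q => c i q *: E i q + \sum_(j <- r) c j q *: E j q).
  by apply/funext => q; rewrite big_cons.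
exact: smooth_vfieldZD (cs i) (Es i) IH.
Qed.

Section Metric.
Variable g : bilinear_field M.
Hypothesis gm : riemannian_metric g.

Lemma metricC p u v : g p u v = g p v u.
Proof. by have [_ gC _ _] := gm; exact: gC. Qed.

Lemma metric_linear p u a v w : g p u (a *: v + w) = a * g p u v + g p u w.
Proof. by have [gl _ _ _] := gm; exact: gl. Qed.

Lemma metricD p u v w : g p u (v + w) = g p u v + g p u w.
Proof. by have := metric_linear p u 1 v w; rewrite scale1r mul1r. Qed.

Lemma metric0 p u : g p u 0 = 0.
Proof. by apply: (addrI (g p u 0)); rewrite -metricD !addr0. Qed.

Lemma metricZ p u a v : g p u (a *: v) = a * g p u v.
Proof. by rewrite -[a *: v]addr0 metric_linear metric0 addr0. Qed.

Lemma metricN p u v : g p u (- v) = - g p u v.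
Proof. by rewrite -scaleN1r metricZ mulN1r. Qed.

Lemma metricB p u v w : g p u (v - w) = g p u v - g p u w.
Proof. by rewrite metricD metricN. Qed.

Lemma metric_sum p u (I : Type) (r : seq I) (F : I -> 'rV[R]_n) :
  g p u (\sum_(i <- r) F i) = \sum_(i <- r) g p u (F i).
Proof.
by elim: r => [|i r IH]; rewrite ?big_nil ?metric0// !big_cons metricD IH.
Qed.

Lemma smooth_inner X Y : smooth_vfield X -> smooth_vfield Y -> smooth_fun (inner g X Y).
Proof. by have [_ _ _ gs] := gm; exact: gs. Qed.

Lemma koszul (D : connection M) X Y Z p : levi_civita g D ->
  smooth_vfield X -> smooth_vfield Y -> smooth_vfield Z ->
  2 * inner g (D X Y) Z p =
  Xderiv X (inner g Y Z) p + Xderiv Y (inner g X Z) p - Xderiv Z (inner g X Y) p +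
  inner g (lie_bracket X Y) Z p - inner g (lie_bracket X Z) Y p
  - inner g (lie_bracket Y Z) X p.
Proof.
move=> [[_ mD] tD] Xs Ys Zs.
have torsion U V W : smooth_vfield U -> smooth_vfield V ->
    inner g (lie_bracket U V) W p = inner g (D U V) W p - inner g (D V U) W p.
  by move=> Us Vs; rewrite /inner -tD // !(metricC _ _ (W p)) metricB.
have metricity U V W : smooth_vfield U -> smooth_vfield V -> smooth_vfield W ->
    Xderiv U (inner g V W) p = inner g (D U V) W p + inner g (D U W) V p.
  by move=> Us Vs Ws; rewrite mD // /inner (metricC p (V p)).
have solve (x y z b1 b2 b3 dxy dxz dyx dyz dzx dzy : R) :
    x = dxy + dxz -> y = dyx + dyz -> z = dzx + dzy ->
    b1 = dxy - dyx -> b2 = dxz - dzx -> b3 = dyz - dzy ->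
    2 * dxy = x + y - z + b1 - b2 - b3.
  by move=> -> -> -> -> -> ->; ring.
exact: (solve _ _ _ _ _ _ _ _ _ _ _ _ (metricity X Y Z Xs Ys Zs)
  (metricity Y X Z Ys Xs Zs) (metricity Z X Y Zs Xs Ys)
  (torsion X Y Z Xs Ys) (torsion X Z Y Xs Zs) (torsion Y Z X Ys Zs)).
Qed.

End Metric.

Lemma d2D (b c : twotensor M) X Y Z p :
  (forall U V, smooth_vfield U -> smooth_vfield V -> smooth_fun (b U V)) ->
  (forall U V, smooth_vfield U -> smooth_vfield V -> smooth_fun (c U V)) ->
  smooth_vfield X -> smooth_vfield Y -> smooth_vfield Z ->
  d2 (fun U V q => b U V q + c U V q) X Y Z p = d2 b X Y Z p + d2 c X Y Z p.
Proof.
move=> bs cs Xs Ys Zs; rewrite /d2.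
rewrite (XderivD X p (bs Y Z Ys Zs) (cs Y Z Ys Zs)).
rewrite (XderivD Y p (bs Z X Zs Xs) (cs Z X Zs Xs)).
rewrite (XderivD Z p (bs X Y Xs Ys) (cs X Y Xs Ys)).
have E (x y z u v w x' y' z' u' v' w' : R) :
  x + x' + (y + y') + (z + z') - (u + u') - (v + v') - (w + w') =
  x + y + z - u - v - w + (x' + y' + z' - u' - v' - w') by ring.
exact: E.
Qed.

Lemma d2N (b : twotensor M) X Y Z p :
  (forall U V, smooth_vfield U -> smooth_vfield V -> smooth_fun (b U V)) ->
  smooth_vfield X -> smooth_vfield Y -> smooth_vfield Z ->
  d2 (fun U V q => - b U V q) X Y Z p = - d2 b X Y Z p.
Proof.
move=> bs Xs Ys Zs; rewrite /d2.
rewrite (XderivN X p (bs Y Z Ys Zs)) (XderivN Y p (bs Z X Zs Xs)).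
rewrite (XderivN Z p (bs X Y Xs Ys)).
have E (x y z u v w : R) :
  - x + - y + - z - - u - - v - - w = - (x + y + z - u - v - w) by ring.
exact: E.
Qed.

Lemma smooth_wedge11 (v w : oneform M) X Y :
  (forall U, smooth_vfield U -> smooth_fun (oneform_app v U)) ->
  (forall U, smooth_vfield U -> smooth_fun (oneform_app w U)) ->
  smooth_vfield X -> smooth_vfield Y -> smooth_fun (wedge11 v w X Y).
Proof.
move=> vs ws Xs Ys; apply: smooth_funB; apply: smooth_funM;
  by [exact: vs|exact: ws].
Qed.

(** The Leibniz rule d(v ∧ w) = dv ∧ w - v ∧ dw, in which the 1-form [v] moves past a 2-form without
    a sign. Only first derivatives of components occur. *)
Lemma d2_wedge11 (v w : oneform M) X Y Z p :
  (forall U, smooth_vfield U -> smooth_fun (oneform_app v U)) ->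
  (forall U, smooth_vfield U -> smooth_fun (oneform_app w U)) ->
  smooth_vfield X -> smooth_vfield Y -> smooth_vfield Z ->
  d2 (wedge11 v w) X Y Z p = wedge21 (d1 v) w X Y Z p - wedge21 (d1 w) v X Y Z p.
Proof.
move=> vs ws Xs Ys Zs.
have XW U V W : smooth_vfield V -> smooth_vfield W ->
    Xderiv U (wedge11 v w V W) p =
    Xderiv U (oneform_app v V) p * w p (W p) + v p (V p) * Xderiv U (oneform_app w W) p
    - (Xderiv U (oneform_app v W) p * w p (V p) +
       v p (W p) * Xderiv U (oneform_app w V) p).
  move=> Vs Ws; have [vV vW] := (vs _ Vs, vs _ Ws); have [wV wW] := (ws _ Vs, ws _ Ws).
  rewrite -(XderivM U p vV wW) -(XderivM U p vW wV).
  exact: (XderivB U p (smooth_funM vV wW) (smooth_funM vW wV)).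
have solve (xvY xvZ yvX yvZ zvX zvY xwY xwZ ywX ywZ zwX zwY
    vX vY vZ wX wY wZ vXY vYZ vZX wXY wYZ wZX x y z : R) :
    x = xvY * wZ + vY * xwZ - (xvZ * wY + vZ * xwY) ->
    y = yvZ * wX + vZ * ywX - (yvX * wZ + vX * ywZ) ->
    z = zvX * wY + vX * zwY - (zvY * wX + vY * zwX) ->
    x + y + z - (vXY * wZ - vZ * wXY) - (vYZ * wX - vX * wYZ)
      - (vZX * wY - vY * wZX) =
    (xvY - yvX - vXY) * wZ + (yvZ - zvY - vYZ) * wX + (zvX - xvZ - vZX) * wY -
    ((xwY - ywX - wXY) * vZ + (ywZ - zwY - wYZ) * vX + (zwX - xwZ - wZX) * vY).
  by move=> -> -> ->; ring.
exact: (solve _ _ _ _ _ _ _ _ _ _ _ _ _ _ _ _ _ _ _ _ _ _ _ _ _ _ _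
  (XW X Y Z Ys Zs) (XW Y Z X Zs Xs) (XW Z X Y Xs Ys)).
Qed.

End FunctionsAndFields.

(** * Orthonormal frames *)

Lemma ord5_ind (P : 'I_5 -> Prop) : P i1 -> P i2 -> P i3 -> P i4 -> P i5 ->
  forall i, P i.
Proof.
move=> P1 P2 P3 P4 P5 [[|[|[|[|[|//]]]]] lt_i].
- by rewrite (_ : Ordinal lt_i = i1) //; exact: val_inj.
- by rewrite (_ : Ordinal lt_i = i2) //; exact: val_inj.
- by rewrite (_ : Ordinal lt_i = i3) //; exact: val_inj.
- by rewrite (_ : Ordinal lt_i = i4) //; exact: val_inj.
- by rewrite (_ : Ordinal lt_i = i5) //; exact: val_inj.
Qed.

Lemma sum_ord5 (V : nmodType) (F : 'I_5 -> V) :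
  \sum_(i < 5) F i = F i1 + F i2 + F i3 + F i4 + F i5.
Proof.
rewrite !big_ord_recl big_ord0 addr0 !addrA.
by congr (F _ + F _ + F _ + F _ + F _); exact: val_inj.
Qed.

Section Frame.
Context {R : realType} {M : manifold R 5}.
Variables (g : bilinear_field M) (E : 'I_5 -> vfield M).
Hypothesis gm : riemannian_metric g.
Hypothesis Es : forall i, smooth_vfield (E i).
Hypothesis Eo : forall i j p, g p (E i p) (E j p) = (i == j)%:R.
Variable d : 'I_5 -> twotensor M.
Hypothesis dE : forall k, eq_two (d1 (flat g (E k))) (d k).
Implicit Types (p : M) (X Y Z : vfield M).

Lemma frame_expansion p v : v = \sum_i g p (E i p) v *: E i p.
Proof.
(* Orthonormality recovers [c] from [c *m B], so the square matrix [B] is invertible and the frame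
   spans. *)
pose B : 'M[R]_5 := \matrix_i E i p.
have gB (c : 'rV[R]_5) j : g p (E j p) (c *m B) = c 0 j.
  rewrite mulmx_sum_row (metric_sum gm) (bigD1 j) //= rowK (metricZ gm) Eo eqxx mulr1.
  rewrite big1 ?addr0 // => i /negPf ij.
  by rewrite rowK (metricZ gm) Eo eq_sym ij mulr0.
have Bu : B \in unitmx.
  rewrite -row_free_unit; apply: inj_row_free => c c0; apply/rowP => j.
  by rewrite -gB c0 (metric0 gm) mxE.
rewrite -{1}(mulmxKV Bu v) mulmx_sum_row; apply: eq_bigr => i _.
by rewrite rowK -{2}(mulmxKV Bu v) gB.
Qed.

Lemma metric_frame p u v :
  g p u v = \sum_i g p (E i p) u * g p (E i p) v.
Proof.
rewrite {1}(frame_expansion p u) (metricC gm) (metric_sum gm).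
by apply: eq_bigr => i _; rewrite (metricZ gm) (metricC gm p v).
Qed.

Lemma frame_ext p u v : (forall i, g p (E i p) u = g p (E i p) v) -> u = v.
Proof.
move=> uv; rewrite (frame_expansion p u) (frame_expansion p v).
by apply: eq_bigr => i _; rewrite uv.
Qed.

Lemma smooth_frame_comp i X : smooth_vfield X ->
  smooth_fun (oneform_app (flat g (E i)) X).
Proof. by move=> Xs; exact: (smooth_inner gm (Es i) Xs). Qed.

Lemma smooth_from_frame X :
  (forall i, smooth_fun (oneform_app (flat g (E i)) X)) -> smooth_vfield X.
Proof.
move=> cs; have -> : X = fun q => \sum_i oneform_app (flat g (E i)) X q *: E i q.
  by apply/funext => q; exact: frame_expansion.
exact: smooth_vfield_sum.
Qed.

Lemma bracket_frame i X Y p : smooth_vfield X -> smooth_vfield Y ->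
  g p (E i p) (lie_bracket X Y p) =
  Xderiv X (oneform_app (flat g (E i)) Y) p -
  Xderiv Y (oneform_app (flat g (E i)) X) p - d i X Y p.
Proof.
move=> Xs Ys.
have solve (a b w c : R) : a - b - w = c -> w = a - b - c by move=> <-; ring.
exact: solve (dE i Xs Ys p).
Qed.

Lemma frame_comp_frame i j : oneform_app (flat g (E i)) (E j) = fun=> (i == j)%:R.
Proof. by apply/funext => p; exact: Eo. Qed.

Lemma inner_frame_comp X i : inner g X (E i) = oneform_app (flat g (E i)) X.
Proof. by apply/funext => p; exact: (metricC gm). Qed.

Lemma bracket_frame_r i j X p : smooth_vfield X ->
  g p (E i p) (lie_bracket X (E j) p) =
  - Xderiv (E j) (oneform_app (flat g (E i)) X) p - d i X (E j) p.
Proof.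
move=> Xs; rewrite (bracket_frame i p Xs (Es j)) frame_comp_frame.
by rewrite (Xderiv_cst X) sub0r.
Qed.

Lemma bracket_frame_l i j X p : smooth_vfield X ->
  g p (E i p) (lie_bracket (E j) X p) =
  Xderiv (E j) (oneform_app (flat g (E i)) X) p - d i (E j) X p.
Proof.
move=> Xs; rewrite (bracket_frame i p (Es j) Xs) frame_comp_frame.
by rewrite (Xderiv_cst X) subr0.
Qed.

Lemma bracket_frame_frame i j k p : g p (E i p) (lie_bracket (E j) (E k) p) =
  - d i (E j) (E k) p.
Proof.
rewrite (bracket_frame_r i k p (Es j)) frame_comp_frame (Xderiv_cst (E k)).
by rewrite oppr0 sub0r.
Qed.

Section Endomorphism.
Variable phi : endo M.
Hypothesis phis : smooth_endo phi.
Hypothesis PhiE : eq_two (Phi g phi) (fun X Y p =>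
  wedge11 (flat g (E i1)) (flat g (E i2)) X Y p +
  wedge11 (flat g (E i3)) (flat g (E i4)) X Y p).

(** [PhiE] speaks of smooth fields only, so it is read on the frame fields and extended to [v] by
    linearity of [phi p]. *)
Lemma phi_frame p i v : g p (E i p) (phi p v) =
  (i == i1)%:R * g p (E i2 p) v - (i == i2)%:R * g p (E i1 p) v +
  (i == i3)%:R * g p (E i4 p) v - (i == i4)%:R * g p (E i3 p) v.
Proof.
have phiE j : g p (E i p) (phi p (E j p)) =
  (i == i1)%:R * (i2 == j)%:R - (i == i2)%:R * (i1 == j)%:R +
  (i == i3)%:R * (i4 == j)%:R - (i == i4)%:R * (i3 == j)%:R.
  have -> : g p (E i p) (phi p (E j p)) = Phi g phi (E i) (E j) p by [].
  rewrite PhiE // /wedge11 /flat !Eo (eq_sym i1 i) (eq_sym i2 i) (eq_sym i3 i).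
  by rewrite (eq_sym i4 i); ring.
rewrite {1}(frame_expansion p v).
pose pM := GRing.isLinear.Build _ _ _ _ (phi p) (phis.1 p).
pose pL : {linear 'rV[R]_5 -> 'rV[R]_5} := HB.pack (phi p) pM.
rewrite -[phi p]/(pL : _ -> _) linear_sum (metric_sum gm) sum_ord5.
rewrite ![pL (_ *: _)]linearZ.
rewrite !(metricZ gm) /= !phiE /=.
move: (g p (E i1 p) v) (g p (E i2 p) v) (g p (E i3 p) v) (g p (E i4 p) v).
move=> x1 x2 x3 x4; ring.
Qed.

Lemma phi_frame1 p v : g p (E i1 p) (phi p v) = g p (E i2 p) v.
Proof. by rewrite phi_frame /=; ring. Qed.
Lemma phi_frame2 p v : g p (E i2 p) (phi p v) = - g p (E i1 p) v.
Proof. by rewrite phi_frame /=; ring. Qed.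
Lemma phi_frame3 p v : g p (E i3 p) (phi p v) = g p (E i4 p) v.
Proof. by rewrite phi_frame /=; ring. Qed.
Lemma phi_frame4 p v : g p (E i4 p) (phi p v) = - g p (E i3 p) v.
Proof. by rewrite phi_frame /=; ring. Qed.
Lemma phi_frame5 p v : g p (E i5 p) (phi p v) = 0.
Proof. by rewrite phi_frame /=; ring. Qed.

Definition phi_frameE :=
  (phi_frame1, phi_frame2, phi_frame3, phi_frame4, phi_frame5).

(** An equality of functions, unlike [eq_two], can be rewritten under the derivatives of [d2]. *)
Lemma PhiE_pointwise : Phi g phi = (fun X Y p =>
  wedge11 (flat g (E i1)) (flat g (E i2)) X Y p +
  wedge11 (flat g (E i3)) (flat g (E i4)) X Y p).
Proof.
apply/funext => X; apply/funext => Y; apply/funext => p.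
rewrite /Phi metric_frame sum_ord5 !phi_frameE /wedge11 /flat; ring.
Qed.

Let split4 p u v w x y :
  g p u (v + w - x - y) = g p u v + g p u w - g p u x - g p u y.
Proof. by rewrite !(metricB gm) (metricD gm). Qed.

Section NijenhuisPair.
Variables k k' : 'I_5.
Hypothesis hk : forall q v, g q (E k q) (phi q v) = g q (E k' q) v.
Hypothesis hk' : forall q v, g q (E k' q) (phi q v) = - g q (E k q) v.

Let comp_k X : oneform_app (flat g (E k)) (endo_app phi X) =
  oneform_app (flat g (E k')) X.
Proof. by apply/funext => q; exact: hk. Qed.

Let comp_k' X : oneform_app (flat g (E k')) (endo_app phi X) =
  fun q => - oneform_app (flat g (E k)) X q.
Proof. by apply/funext => q; exact: hk'. Qed.

Variables (Y Z : vfield M) (p : M).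
Hypotheses (Ys : smooth_vfield Y) (Zs : smooth_vfield Z).

(** Here [phi] rotates the plane of [E k] and [E k']. The derivatives of components in the four
    brackets cancel, and only values of [d k] and [d k'] remain. *)
Lemma nijenhuis_bracket_frame :
  g p (E k p) (nijenhuis_bracket phi Y Z p) =
  - d k (endo_app phi Y) (endo_app phi Z) p
  + d k Y Z p
  + d k' (endo_app phi Y) Z p
  + d k' Y (endo_app phi Z) p.
Proof.
have [Ys' Zs'] := (phis.2 _ Ys, phis.2 _ Zs).
rewrite /nijenhuis_bracket split4.
have f2 := etrans (hk p (phi p (lie_bracket Y Z p))) (hk' p (lie_bracket Y Z p)).
have f3 := hk p (lie_bracket (endo_app phi Y) Z p).
have f4 := hk p (lie_bracket Y (endo_app phi Z) p).
have e1 := bracket_frame k p Ys' Zs'.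
have e2 := bracket_frame k p Ys Zs.
have e3 := bracket_frame k' p Ys' Zs.
have e4 := bracket_frame k' p Ys Zs'.
rewrite !comp_k in e1; rewrite comp_k' in e3; rewrite comp_k' in e4.
rewrite (XderivN Z p (smooth_frame_comp k Ys)) in e3.
rewrite (XderivN Y p (smooth_frame_comp k Zs)) in e4.
have solve (b1 b2 b3 b4 n2 n3 n4 x1 x2 x3 x4 d1 d2 d3 d4 : R) :
  b1 = x1 - x2 - d1 -> b2 = x3 - x4 - d2 -> b3 = x1 - - x4 - d3 ->
  b4 = - x3 - x2 - d4 -> n2 = - b2 -> n3 = b3 -> n4 = b4 ->
  b1 + n2 - n3 - n4 = - d1 + d2 + d3 + d4.
  by move=> -> -> -> -> -> -> ->; ring.
exact: (solve _ _ _ _ _ _ _ _ _ _ _ _ _ _ _ e1 e2 e3 e4 f2 f3 f4).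
Qed.

Lemma nijenhuis_bracket_frame' :
  g p (E k' p) (nijenhuis_bracket phi Y Z p) =
  - d k' (endo_app phi Y) (endo_app phi Z) p
  + d k' Y Z p
  - d k (endo_app phi Y) Z p
  - d k Y (endo_app phi Z) p.
Proof.
have [Ys' Zs'] := (phis.2 _ Ys, phis.2 _ Zs).
rewrite /nijenhuis_bracket split4.
have f2 := etrans (hk' p (phi p (lie_bracket Y Z p)))
  (congr1 -%R (hk p (lie_bracket Y Z p))).
have f3 := hk' p (lie_bracket (endo_app phi Y) Z p).
have f4 := hk' p (lie_bracket Y (endo_app phi Z) p).
have e1 := bracket_frame k' p Ys' Zs'.
have e2 := bracket_frame k' p Ys Zs.
have e3 := bracket_frame k p Ys' Zs.
have e4 := bracket_frame k p Ys Zs'.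
rewrite !comp_k' in e1; rewrite comp_k in e3; rewrite comp_k in e4.
rewrite (XderivN _ p (smooth_frame_comp k Ys)) in e1.
rewrite (XderivN _ p (smooth_frame_comp k Zs)) in e1.
have solve (b1 b2 b3 b4 n2 n3 n4 x1 x2 x3 x4 d1 d2 d3 d4 : R) :
  b1 = - x1 - - x2 - d1 -> b2 = x3 - x4 - d2 -> b3 = x1 - x4 - d3 ->
  b4 = x3 - x2 - d4 -> n2 = - b2 -> n3 = - b3 -> n4 = - b4 ->
  b1 + n2 - n3 - n4 = - d1 + d2 - d3 - d4.
  by move=> -> -> -> -> -> -> ->; ring.
exact: (solve _ _ _ _ _ _ _ _ _ _ _ _ _ _ _ e1 e2 e3 e4 f2 f3 f4).
Qed.

End NijenhuisPair.

(** The image of [phi] has no component along [E i5], so only the first bracket contributes, and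
    without derivative terms. *)
Lemma nijenhuis_bracket_frame5 Y Z p : smooth_vfield Y -> smooth_vfield Z ->
  g p (E i5 p) (nijenhuis_bracket phi Y Z p) =
  - d i5 (endo_app phi Y) (endo_app phi Z) p.
Proof.
move=> Ys Zs; have [Ys' Zs'] := (phis.2 _ Ys, phis.2 _ Zs).
have c5 X : oneform_app (flat g (E i5)) (endo_app phi X) = fun=> 0.
  by apply/funext => q; exact: phi_frame5.
have e1 := bracket_frame i5 p Ys' Zs'.
rewrite !c5 (Xderiv_cst (endo_app phi Y)) (Xderiv_cst (endo_app phi Z)) in e1.
have solve (b1 n2 n3 n4 d1 : R) : b1 = 0 - 0 - d1 -> n2 = 0 -> n3 = 0 -> n4 = 0 ->
  b1 + n2 - n3 - n4 = - d1 by move=> -> -> -> ->; ring.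
rewrite /nijenhuis_bracket split4.
exact: (solve _ _ _ _ _ e1 (phi_frame5 _ _) (phi_frame5 _ _) (phi_frame5 _ _)).
Qed.

End Endomorphism.
End Frame.

(** * Consequences of the structure equations *)

Section StructureEquations.
Context {R : realType} {M : manifold R 5}.
Variables (g : bilinear_field M) (E : 'I_5 -> vfield M) (phi : endo M).
Hypothesis gm : riemannian_metric g.
Hypothesis Es : forall i, smooth_vfield (E i).
Hypothesis Eo : forall i j p, g p (E i p) (E j p) = (i == j)%:R.
Hypothesis phis : smooth_endo phi.
Hypothesis PhiE : eq_two (Phi g phi) (fun X Y p =>
  wedge11 (flat g (E i1)) (flat g (E i2)) X Y p +
  wedge11 (flat g (E i3)) (flat g (E i4)) X Y p).
Implicit Types (p : M) (X Y Z : vfield M).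

Local Notation e i := (flat g (E i)).
Local Notation F := (fun X Y p =>
  wedge11 (e i1) (e i2) X Y p - wedge11 (e i3) (e i4) X Y p).

Variables (A : oneform M) (a1 a2 a3 a4 : R).

(** The right-hand sides of the structure equations as one family indexed by [k], to instantiate the
    family [d] of the section on frames; [A] is meant to be the pullback of A_2. *)
Definition frame_d (k : 'I_5) : twotensor M := fun X Y p =>
  (k == i1)%:R * (wedge11 A (e i2) X Y p - (2 * a1 + a3) * wedge11 (e i3) (e i5) X Y p
    - (2 * a2 + a4) * wedge11 (e i4) (e i5) X Y p) +
  (k == i2)%:R * (- wedge11 A (e i1) X Y p + (2 * a1 + a3) * wedge11 (e i4) (e i5) X Y p
    - (2 * a2 + a4) * wedge11 (e i3) (e i5) X Y p) +
  (k == i3)%:R * (- wedge11 A (e i4) X Y p + (2 * a1 + a3) * wedge11 (e i1) (e i5) X Y p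
    + (2 * a2 + a4) * wedge11 (e i2) (e i5) X Y p) +
  (k == i4)%:R * (wedge11 A (e i3) X Y p - (2 * a1 + a3) * wedge11 (e i2) (e i5) X Y p
    + (2 * a2 + a4) * wedge11 (e i1) (e i5) X Y p) +
  (k == i5)%:R * (- (2 * (a1 - a3)) * (wedge11 (e i1) (e i3) X Y p
      - wedge11 (e i2) (e i4) X Y p)
    - 2 * (a2 - a4) * (wedge11 (e i1) (e i4) X Y p + wedge11 (e i2) (e i3) X Y p)).

Hypothesis dE : forall k, eq_two (d1 (e k)) (frame_d k).

Let phisf X : smooth_vfield X -> smooth_vfield (endo_app phi X).
Proof. exact: phis.2. Qed.

Let phiE := phi_frameE gm Es Eo phis PhiE.

(** Twice the sum of the e_i(X) de_i(Y, Z) stripped of [A]. The terms in [A] commute with φ and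
    cancel. The others are doubled: the coefficients of ∧ e_5 in de_1, ..., de_4 anticommute with φ,
    and de_5 changes sign under (φ, φ). *)
Definition nijenhuis_frame : threetensor M := fun X Y Z p =>
  2 * (e i1 p (X p) * (- (2 * a1 + a3) * wedge11 (e i3) (e i5) Y Z p
         - (2 * a2 + a4) * wedge11 (e i4) (e i5) Y Z p)
     + e i2 p (X p) * ((2 * a1 + a3) * wedge11 (e i4) (e i5) Y Z p
         - (2 * a2 + a4) * wedge11 (e i3) (e i5) Y Z p)
     + e i3 p (X p) * ((2 * a1 + a3) * wedge11 (e i1) (e i5) Y Z p
         + (2 * a2 + a4) * wedge11 (e i2) (e i5) Y Z p)
     + e i4 p (X p) * (- (2 * a1 + a3) * wedge11 (e i2) (e i5) Y Z p
         + (2 * a2 + a4) * wedge11 (e i1) (e i5) Y Z p)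
     + e i5 p (X p) * frame_d i5 Y Z p).

Lemma nijenhuisE X Y Z p : smooth_vfield Y -> smooth_vfield Z ->
  nijenhuis g (e i5) phi X Y Z p = nijenhuis_frame X Y Z p.
Proof.
move=> Ys Zs; have [Ys' Zs'] := (phisf Ys, phisf Zs).
have NX : nijenhuis g (e i5) phi X Y Z p =
    e i1 p (X p) * e i1 p (nijenhuis_bracket phi Y Z p) +
    e i2 p (X p) * e i2 p (nijenhuis_bracket phi Y Z p) +
    e i3 p (X p) * e i3 p (nijenhuis_bracket phi Y Z p) +
    e i4 p (X p) * e i4 p (nijenhuis_bracket phi Y Z p) +
    e i5 p (X p) * e i5 p (nijenhuis_bracket phi Y Z p) +
    e i5 p (X p) * d1 (e i5) Y Z p.
  exact: (congr1 (fun z => z + _) (etrans (metric_frame gm Eo p (X p) _) (sum_ord5 _))).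
have solve (x1 x2 x3 x4 x5 n1 n2 n3 n4 n5 w1 w2 w3 w4 w5 d v n : R) :
    n = x1 * n1 + x2 * n2 + x3 * n3 + x4 * n4 + x5 * n5 + x5 * d ->
    n1 = w1 -> n2 = w2 -> n3 = w3 -> n4 = w4 -> n5 = w5 -> d = v ->
    n = x1 * w1 + x2 * w2 + x3 * w3 + x4 * w4 + x5 * w5 + x5 * v.
  by move=> + <- <- <- <- <- <-.
have [[[[f1 f2] f3] f4] f5] := phiE.
apply: (etrans (solve _ _ _ _ _ _ _ _ _ _ _ _ _ _ _ _ _ _ NX
  (nijenhuis_bracket_frame gm Es dE phis f1 f2 p Ys Zs)
  (nijenhuis_bracket_frame' gm Es dE phis f1 f2 p Ys Zs)
  (nijenhuis_bracket_frame gm Es dE phis f3 f4 p Ys Zs)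
  (nijenhuis_bracket_frame' gm Es dE phis f3 f4 p Ys Zs)
  (nijenhuis_bracket_frame5 gm Es Eo dE phis PhiE p Ys Zs)
  (dE i5 Ys Zs p))).
rewrite /nijenhuis_frame /frame_d /= /wedge11 /flat /endo_app !phiE.
ring.
Qed.

(** The 2-form β in dΦ = β ∧ η. The terms in [A] vanish because a rotation of a plane preserves its
    area form. *)
Definition Phi_frame_d : twotensor M := fun X Y p =>
  - 2 * ((2 * a1 + a3) * (wedge11 (e i1) (e i4) X Y p + wedge11 (e i2) (e i3) X Y p)
       + (2 * a2 + a4) * (wedge11 (e i2) (e i4) X Y p - wedge11 (e i1) (e i3) X Y p)).

Let cs i U : smooth_vfield U -> smooth_fun (oneform_app (e i) U).
Proof. exact: (smooth_frame_comp gm Es). Qed.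

Let ws i j U V : smooth_vfield U -> smooth_vfield V ->
  smooth_fun (wedge11 (e i) (e j) U V).
Proof. by move=> Us Vs; apply: smooth_wedge11 => // W; exact: cs. Qed.

Lemma d2_wedge_frame i j X Y Z p :
  smooth_vfield X -> smooth_vfield Y -> smooth_vfield Z ->
  d2 (wedge11 (e i) (e j)) X Y Z p =
  wedge21 (frame_d i) (e j) X Y Z p - wedge21 (frame_d j) (e i) X Y Z p.
Proof.
move=> Xs Ys Zs.
apply: (etrans (d2_wedge11 p (@cs i) (@cs j) Xs Ys Zs)).
have w21 k l : wedge21 (d1 (e k)) (e l) X Y Z p = wedge21 (frame_d k) (e l) X Y Z p.
  have solve (a b c a' b' c' x y z : R) : a = a' -> b = b' -> c = c' ->
    a * x + b * y + c * z = a' * x + b' * y + c' * z by move=> -> -> ->.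
  exact: (solve _ _ _ _ _ _ _ _ _ (dE k Xs Ys p) (dE k Ys Zs p) (dE k Zs Xs p)).
exact: (f_equal2 (fun a b => a - b) (w21 i j) (w21 j i)).
Qed.

Lemma d2_PhiE X Y Z p : smooth_vfield X -> smooth_vfield Y -> smooth_vfield Z ->
  d2 (Phi g phi) X Y Z p = wedge21 Phi_frame_d (e i5) X Y Z p.
Proof.
move=> Xs Ys Zs; rewrite (PhiE_pointwise gm Es Eo phis PhiE).
apply: (etrans (d2D p (@ws i1 i2) (@ws i3 i4) Xs Ys Zs)).
apply: (etrans (f_equal2 +%R (d2_wedge_frame i1 i2 p Xs Ys Zs)
  (d2_wedge_frame i3 i4 p Xs Ys Zs))).
rewrite /Phi_frame_d /wedge21 /frame_d /= /wedge11 /flat.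
ring.
Qed.

(** The forms e_1 ∧ e_2 and e_3 ∧ e_4 have the same exterior derivative: it doubles in dΦ and
    cancels here. *)
Lemma d2_F X Y Z p : smooth_vfield X -> smooth_vfield Y -> smooth_vfield Z ->
  d2 F X Y Z p = 0.
Proof.
move=> Xs Ys Zs.
have ws34 U V : smooth_vfield U -> smooth_vfield V ->
    smooth_fun (fun q => - wedge11 (e i3) (e i4) U V q).
  by move=> Us Vs; apply: smooth_funN; exact: ws.
apply: (etrans (d2D p (@ws i1 i2) ws34 Xs Ys Zs)).
apply: (etrans (f_equal2 +%R (d2_wedge_frame i1 i2 p Xs Ys Zs)
  (etrans (d2N p (@ws i3 i4) Xs Ys Zs)
     (congr1 -%R (d2_wedge_frame i3 i4 p Xs Ys Zs))))).
rewrite /wedge21 /frame_d /= /wedge11 /flat.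
ring.
Qed.

(** The derivatives of components agree on both sides. What remains is that the matrix of the
    de_k(E_5, E_j) is skew, which the last [ring] verifies. *)
Lemma killing_frame5 : killing g (E i5).
Proof.
split=> [|X Y Xs Ys p]; first exact: Es.
have gE U V : inner g U V = fun q =>
    oneform_app (e i1) U q * oneform_app (e i1) V q +
    oneform_app (e i2) U q * oneform_app (e i2) V q +
    oneform_app (e i3) U q * oneform_app (e i3) V q +
    oneform_app (e i4) U q * oneform_app (e i4) V q +
    oneform_app (e i5) U q * oneform_app (e i5) V q.
  by apply/funext => q; exact: (etrans (metric_frame gm Eo q (U q) (V q)) (sum_ord5 _)).
have cXY i : smooth_fun (fun q => oneform_app (e i) X q * oneform_app (e i) Y q).
  by apply: smooth_funM; exact: cs.
have dXY i : Xderiv (E i5) (fun q => oneform_app (e i) X q * oneform_app (e i) Y q) p =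
    Xderiv (E i5) (oneform_app (e i) X) p * e i p (Y p) +
    e i p (X p) * Xderiv (E i5) (oneform_app (e i) Y) p.
  exact: (XderivM (E i5) p (cs i Xs) (cs i Ys)).
have s12 := smooth_funD (cXY i1) (cXY i2); have s123 := smooth_funD s12 (cXY i3).
have s1234 := smooth_funD s123 (cXY i4).
have D5 := etrans (XderivD (E i5) p s1234 (cXY i5)) (f_equal2 +%R
  (etrans (XderivD (E i5) p s123 (cXY i4)) (f_equal2 +%R
    (etrans (XderivD (E i5) p s12 (cXY i3)) (f_equal2 +%R
      (etrans (XderivD (E i5) p (cXY i1) (cXY i2)) (f_equal2 +%R (dXY i1) (dXY i2)))
      (dXY i3))) (dXY i4))) (dXY i5)).
have bX i := bracket_frame_l Es Eo dE i i5 p Xs.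
have bY i := bracket_frame_l Es Eo dE i i5 p Ys.
have gX := etrans (metric_frame gm Eo p (lie_bracket (E i5) X p) (Y p)) (sum_ord5 _).
have gY := etrans (metric_frame gm Eo p (X p) (lie_bracket (E i5) Y p)) (sum_ord5 _).
have solve (x1 x2 x3 x4 x5 y1 y2 y3 y4 y5 u1 u2 u3 u4 u5 v1 v2 v3 v4 v5
    b1 b2 b3 b4 b5 c1 c2 c3 c4 c5 d1 d2 d3 d4 d5 e1 e2 e3 e4 e5 s t : R) :
    s = b1 * y1 + b2 * y2 + b3 * y3 + b4 * y4 + b5 * y5 ->
    t = x1 * c1 + x2 * c2 + x3 * c3 + x4 * c4 + x5 * c5 ->
    b1 = u1 - d1 -> b2 = u2 - d2 -> b3 = u3 - d3 -> b4 = u4 - d4 -> b5 = u5 - d5 ->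
    c1 = v1 - e1 -> c2 = v2 - e2 -> c3 = v3 - e3 -> c4 = v4 - e4 -> c5 = v5 - e5 ->
    d1 * y1 + d2 * y2 + d3 * y3 + d4 * y4 + d5 * y5
      + (x1 * e1 + x2 * e2 + x3 * e3 + x4 * e4 + x5 * e5) = 0 ->
    u1 * y1 + x1 * v1 + (u2 * y2 + x2 * v2) + (u3 * y3 + x3 * v3)
    + (u4 * y4 + x4 * v4) + (u5 * y5 + x5 * v5) = s + t.
  move=> -> -> -> -> -> -> -> -> -> -> -> -> de0.
  by apply/eqP; rewrite -subr_eq0 -[X in _ == X]de0; apply/eqP; ring.
rewrite gE; apply: (etrans D5).
apply: (solve _ _ _ _ _ _ _ _ _ _ _ _ _ _ _ _ _ _ _ _ _ _ _ _ _ _ _ _ _ _ _ _ _ _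
  _ _ _ _ _ _ _ _ gX gY (bX i1) (bX i2) (bX i3) (bX i4) (bX i5)
  (bY i1) (bY i2) (bY i3) (bY i4) (bY i5)).
rewrite /frame_d /= /wedge11 /flat !Eo /=.
ring.
Qed.

Lemma nijenhuis_frame5 X Y p : nijenhuis_frame (E i5) X Y p = 2 * frame_d i5 X Y p.
Proof. by rewrite /nijenhuis_frame /flat !Eo /=; ring. Qed.

(** A point of the manifold is needed to read off conditions on the constants. *)
Lemma nijenhuis_skewE : (exists p : M, True) ->
  totally_skew (nijenhuis g (e i5) phi) <-> a3 = 0 /\ a4 = 0.
Proof.
move=> [p _]; split=> [sk|[a30 a40] X Y Z Xs Ys Zs q].
  have sk' i j k : nijenhuis_frame (E i) (E j) (E k) p +
      nijenhuis_frame (E j) (E i) (E k) p = 0.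
    by rewrite -!nijenhuisE //; exact: sk.
  (* These two sums are [6 * a3] and [6 * a4]. *)
  have := sk' i5 i1 i3; have := sk' i5 i1 i4.
  rewrite /nijenhuis_frame /frame_d /= /wedge11 /flat !Eo /= => e1 e2.
  split; lra.
rewrite !nijenhuisE // /nijenhuis_frame /frame_d /= /wedge11 /flat a30 a40; ring.
Qed.

Lemma nijenhuis_cyclicE : (exists p : M, True) ->
  traceless_cyclic E (nijenhuis g (e i5) phi) <-> a1 = 0 /\ a2 = 0.
Proof.
move=> [p _]; split=> [[cy _]|[a10 a20]].
  have cy' i j k : nijenhuis_frame (E i) (E j) (E k) p +
      nijenhuis_frame (E j) (E k) (E i) p + nijenhuis_frame (E k) (E i) (E j) p = 0.
    by rewrite -!nijenhuisE //; exact: cy.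
  (* These two cyclic sums are [- 12 * a1] and [- 12 * a2]. *)
  have := cy' i5 i1 i3; have := cy' i5 i1 i4.
  rewrite /nijenhuis_frame /frame_d /= /wedge11 /flat !Eo /= => e1 e2.
  split; lra.
split=> [X Y Z Xs Ys Zs q|X Xs q].
  rewrite !nijenhuisE // /nijenhuis_frame /frame_d /= /wedge11 /flat a10 a20; ring.
apply: (etrans (eq_bigr _ (fun i _ => nijenhuisE (E i) q (Es i) Xs))).
rewrite sum_ord5 /nijenhuis_frame /frame_d /= /wedge11 /flat !Eo /=.
ring.
Qed.

End StructureEquations.

(** * The canonical connection and its curvature *)

Section Connection.
Context {R : realType} {M : manifold R 5}.
Variables (g : bilinear_field M) (E : 'I_5 -> vfield M) (phi : endo M).
Hypothesis gm : riemannian_metric g.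
Hypothesis Es : forall i, smooth_vfield (E i).
Hypothesis Eo : forall i j p, g p (E i p) (E j p) = (i == j)%:R.
Hypothesis phis : smooth_endo phi.
Hypothesis PhiE : eq_two (Phi g phi) (fun X Y p =>
  wedge11 (flat g (E i1)) (flat g (E i2)) X Y p +
  wedge11 (flat g (E i3)) (flat g (E i4)) X Y p).
Implicit Types (p : M) (X Y Z W : vfield M).

Local Notation e i := (flat g (E i)).

Variables (A : oneform M) (a1 a2 a3 a4 alpha : R).
Hypothesis dE : forall k, eq_two (d1 (e k)) (frame_d g E A a1 a2 a3 a4 k).

Definition frame_F : twotensor M := fun X Y p =>
  wedge11 (e i1) (e i2) X Y p - wedge11 (e i3) (e i4) X Y p.

Hypothesis dA : eq_two (d1 A) (fun X Y p => alpha * frame_F X Y p).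

Variables (Dg Dc : connection M).
Hypothesis LC : levi_civita g Dg.
Hypothesis CC : canonical_connection g (E i5) (e i5) phi Dg Dc.

Local Notation fd := (frame_d g E A a1 a2 a3 a4).

Let phisf X : smooth_vfield X -> smooth_vfield (endo_app phi X).
Proof. exact: phis.2. Qed.

Let phiE := phi_frameE gm Es Eo phis PhiE.

(** In the Koszul formula the derivatives of the components of [X] cancel against those in its
    brackets with [E i] and [E j]. This leaves an identity between values of [frame_d], N and dΦ,
    linear in [X]. *)
Lemma connection_frame i j X p : smooth_vfield X ->
  inner g (Dc X (E i)) (E j) p = A p (X p) * frame_F (E i) (E j) p.
Proof.
move=> Xs.
have k0 : Xderiv X (inner g (E i) (E j)) p = 0.
  have -> : inner g (E i) (E j) = fun=> (i == j)%:R.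
    by apply/funext => q; exact: Eo.
  exact: Xderiv_cst.
have k1 := congr1 (fun f => Xderiv (E i) f p) (inner_frame_comp E gm X j).
have k2 := congr1 (fun f => Xderiv (E j) f p) (inner_frame_comp E gm X i).
have b1 := etrans (metricC gm p (lie_bracket X (E i) p) (E j p))
  (bracket_frame_r Es Eo dE j i p Xs).
have b2 := etrans (metricC gm p (lie_bracket X (E j) p) (E i p))
  (bracket_frame_r Es Eo dE i j p Xs).
have b3 := etrans (metric_frame gm Eo p (lie_bracket (E i) (E j) p) (X p)) (sum_ord5 _).
have b4 k := bracket_frame_frame Es Eo dE k i j p.
have gam U V : smooth_vfield U -> smooth_vfield V ->
    d1 (e i5) U V p - gamma_form g (E i5) phi U V p = fd i5 U V p -
    wedge21 (Phi_frame_d g E a1 a2 a3 a4) (e i5) (E i5) (endo_app phi U) V p.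
  move=> Us Vs; apply: (f_equal2 (fun a b => a - b) (dE i5 Us Vs p)).
  exact: (d2_PhiE gm Es Eo phis PhiE dE p (Es i5) (phisf Us) Vs).
have solve (D G s0 s1 s2 t1 t2 c1 c2 c3 u1 u2 u3 u4 u5 x1 x2 x3 x4 x5
    f1 f2 f3 f4 f5 fj fi g1 g2 g3 h1 h2 h3 y1 y2 y3 N n r : R) :
    2 * G = s0 + s1 - s2 + c1 - c2 - c3 ->
    D = G + 2^-1 * (g1 * y1 + g2 * y2 + g3 * y3 - N) ->
    s0 = 0 -> s1 = t1 -> s2 = t2 -> c1 = - t1 - fj -> c2 = - t2 - fi ->
    c3 = u1 * x1 + u2 * x2 + u3 * x3 + u4 * x4 + u5 * x5 ->
    u1 = - f1 -> u2 = - f2 -> u3 = - f3 -> u4 = - f4 -> u5 = - f5 ->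
    g1 = h1 -> g2 = h2 -> g3 = h3 -> N = n ->
    - fj + fi + (f1 * x1 + f2 * x2 + f3 * x3 + f4 * x4 + f5 * x5)
    + (h1 * y1 + h2 * y2 + h3 * y3) - n = 2 * r -> D = r.
  move=> KG -> s00 s1t s2t c1E c2E c3E u1E u2E u3E u4E u5E -> -> -> -> rE.
  rewrite s00 s1t s2t c1E c2E c3E u1E u2E u3E u4E u5E in KG.
  have -> : G = 2^-1 * (2 * G) by rewrite mulKf // pnatr_eq0.
  have -> : r = 2^-1 * (2 * r) by rewrite mulKf // pnatr_eq0.
  by rewrite KG -rE -mulrDr; congr (_ * _); ring.
apply: (solve _ _ _ _ _ _ _ _ _ _ _ _ _ _ _ _ _ _ _ _ _ _ _ _ _ _ _ _ _ _ _ _ _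
  _ _ _ _ _ _ (koszul gm p LC Xs (Es i) (Es j)) (CC.2 X (E i) (E j) Xs (Es i) (Es j) p)
  k0 k1 k2 b1 b2 b3 (b4 i1) (b4 i2) (b4 i3) (b4 i4) (b4 i5)
  (gam X (E i) Xs (Es i)) (gam (E i) (E j) (Es i) (Es j)) (gam (E j) X (Es j) Xs)
  (nijenhuisE gm Es Eo phis PhiE dE X p (Es i) (Es j))).
rewrite /nijenhuis_frame /wedge21 /Phi_frame_d /frame_d /frame_F /wedge11 /flat /=.
rewrite /endo_app !phiE !Eo.
(* For each of the 25 index pairs this is a polynomial identity in the a_i, the values of [A] and
   the components of [X]. *)
clear k0 k1 k2 b1 b2 b3 b4; move: i j; apply: ord5_ind; apply: ord5_ind => /=; ring.
Qed.

Lemma frame_F_frame p : frame_F (E i1) (E i2) p = 1.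
Proof. by rewrite /frame_F /wedge11 /flat !Eo /=; ring. Qed.

Lemma frame_F_phi X Y p : frame_F (endo_app phi X) (endo_app phi Y) p = frame_F X Y p.
Proof. by rewrite /frame_F /wedge11 /flat /endo_app !phiE; ring. Qed.

Lemma frame_FC X Y p : frame_F X Y p = - frame_F Y X p.
Proof. by rewrite /frame_F /wedge11; ring. Qed.

Lemma frame_F_linear X Y Z (f : M -> R) p :
  frame_F (fun q => f q *: X q + Y q) Z p = f p * frame_F X Z p + frame_F Y Z p.
Proof.
by rewrite /frame_F /wedge11 /flat !(metric_linear gm); ring.
Qed.

Let cs i U : smooth_vfield U -> smooth_fun (oneform_app (e i) U).
Proof. exact: (smooth_frame_comp gm Es). Qed.

Let ws i j U V : smooth_vfield U -> smooth_vfield V ->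
  smooth_fun (wedge11 (e i) (e j) U V).
Proof. by move=> Us Vs; apply: smooth_wedge11 => // W; exact: cs. Qed.

Lemma smooth_frame_F X Y : smooth_vfield X -> smooth_vfield Y ->
  smooth_fun (frame_F X Y).
Proof. by move=> Xs Ys; apply: smooth_funB; exact: ws. Qed.

Let Dc_smooth U V : smooth_vfield U -> smooth_vfield V -> smooth_vfield (Dc U V).
Proof. have [[[Ds _ _ _] _] _] := CC; exact: Ds. Qed.

(* The connection form of [Dc] is A, so A is smooth because [Dc] is. *)
Lemma smooth_connection_form X : smooth_vfield X -> smooth_fun (oneform_app A X).
Proof.
move=> Xs; have -> : oneform_app A X = inner g (Dc X (E i1)) (E i2).
  by apply/funext => q; rewrite connection_frame // frame_F_frame mulr1.
exact: (smooth_inner gm (Dc_smooth Xs (Es i1)) (Es i2)).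
Qed.

Lemma smooth_frame_d k X Y : smooth_vfield X -> smooth_vfield Y ->
  smooth_fun (fd k X Y).
Proof.
move=> Xs Ys; have wA i : smooth_fun (wedge11 A (e i) X Y).
  apply: smooth_wedge11 => // W; [exact: smooth_connection_form|exact: cs].
have wM i j b : smooth_fun (fun q => b * wedge11 (e i) (e j) X Y q).
  by apply: smooth_funM; [exact: smooth_fun_cst|exact: ws].
have cM (b : R) (f : M -> R) : smooth_fun f -> smooth_fun (fun q => b * f q).
  by move=> fs; apply: smooth_funM; first exact: smooth_fun_cst.
apply: smooth_funD; last first.
  apply: (cM); apply: smooth_funB; first by apply: (cM); apply: smooth_funB; exact: ws.
  by apply: (cM); apply: smooth_funD; exact: ws.
apply: smooth_funD; last first.
  apply: (cM); apply: smooth_funD; last exact: wM.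
  by apply: smooth_funB; [exact: wA|exact: wM].
apply: smooth_funD; last first.
  apply: (cM); apply: smooth_funD; last exact: wM.
  by apply: smooth_funD; [apply: smooth_funN; exact: wA|exact: wM].
apply: smooth_funD; last first.
  apply: (cM); apply: smooth_funB; last exact: wM.
  by apply: smooth_funD; [apply: smooth_funN; exact: wA|exact: wM].
apply: (cM); apply: smooth_funB; last exact: wM.
by apply: smooth_funB; [exact: wA|exact: wM].
Qed.

(** The curvature applies [Dc] along a bracket, and [Dc] is controlled on smooth fields only. In the
    frame the components of the bracket involve [fd], hence [A], whose smoothness is used here. *)
Lemma smooth_lie_bracket X Y : smooth_vfield X -> smooth_vfield Y ->
  smooth_vfield (lie_bracket X Y).
Proof.
move=> Xs Ys; apply: (smooth_from_frame gm Es Eo) => i.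
have -> : oneform_app (e i) (lie_bracket X Y) =
    fun q => Xderiv X (oneform_app (e i) Y) q - Xderiv Y (oneform_app (e i) X) q
             - fd i X Y q.
  by apply/funext => q; exact: (bracket_frame dE i q Xs Ys).
apply: smooth_funB; last exact: smooth_frame_d.
by apply: smooth_funB; apply: smooth_Xderiv => //; exact: cs.
Qed.

(** Metricity against [E j] moves [Dc] from [Z] onto the frame, where the connection form is
    known. *)
Lemma connection_comp j X Z : smooth_vfield X -> smooth_vfield Z ->
  oneform_app (e j) (Dc X Z) =
  fun q => Xderiv X (oneform_app (e j) Z) q - A q (X q) * frame_F (E j) Z q.
Proof.
move=> Xs Zs; apply/funext => q.
have mD := CC.1.2 X Z (E j) Xs Zs (Es j) q.
have k1 := congr1 (fun f => Xderiv X f q) (inner_frame_comp E gm Z j).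
have k2 := metricC gm q (Dc X Z q) (E j q).
have k3 := etrans (metric_frame gm Eo q (Z q) (Dc X (E j) q)) (sum_ord5 _).
have k4 k := etrans (metricC gm q (E k q) (Dc X (E j) q)) (connection_frame j k q Xs).
have solve (D D' S T x z1 z2 z3 z4 z5 w1 w2 w3 w4 w5 v1 v2 v3 v4 v5 a f : R) :
  S = D + T -> S = x -> D = D' ->
  T = z1 * w1 + z2 * w2 + z3 * w3 + z4 * w4 + z5 * w5 ->
  w1 = a * v1 -> w2 = a * v2 -> w3 = a * v3 -> w4 = a * v4 -> w5 = a * v5 ->
  z1 * v1 + z2 * v2 + z3 * v3 + z4 * v4 + z5 * v5 = f -> D' = x - a * f.
  move=> SE <- <- TE w1E w2E w3E w4E w5E <-.
  rewrite SE TE w1E w2E w3E w4E w5E; ring.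
apply: (solve _ _ _ _ _ _ _ _ _ _ _ _ _ _ _ _ _ _ _ _ _ _ mD k1 k2 k3
  (k4 i1) (k4 i2) (k4 i3) (k4 i4) (k4 i5)).
rewrite /frame_F /wedge11 /flat !Eo.
clear mD k1 k2 k3 k4; move: j; apply: ord5_ind => /=; ring.
Qed.

Section CurvaturePair.
Variables (k k' : 'I_5) (s : R).
Hypothesis Fk : forall V q, frame_F (E k) V q = s * e k' q (V q).
Hypothesis Fk' : forall V q, frame_F (E k') V q = - s * e k q (V q).

Let Hk U V : smooth_vfield U -> smooth_vfield V ->
  oneform_app (e k) (Dc U V) = fun q => Xderiv U (oneform_app (e k) V) q
    - s * (oneform_app A U q * oneform_app (e k') V q).
Proof.
move=> Us Vs; apply: (etrans (connection_comp k Us Vs)); apply/funext => q.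
by apply: (congr1 (fun z => _ - z)); rewrite Fk mulrCA.
Qed.

Let Hk' U V : smooth_vfield U -> smooth_vfield V ->
  oneform_app (e k') (Dc U V) = fun q => Xderiv U (oneform_app (e k') V) q
    + s * (oneform_app A U q * oneform_app (e k) V q).
Proof.
move=> Us Vs; apply: (etrans (connection_comp k' Us Vs)); apply/funext => q.
by apply: (congr1 (fun z => _ + z)); rewrite Fk' mulrCA mulNr opprK.
Qed.

(** The terms quadratic in [A] are symmetric in [X] and [Y] and cancel. The second derivatives
    cancel by [Xderiv_bracket], the mixed terms among themselves, and the derivatives of [A]
    assemble into dA. *)
Lemma curvature_pair X Y Z p :
  smooth_vfield X -> smooth_vfield Y -> smooth_vfield Z ->
  g p (E k p) (curvature Dc X Y Z p) =
  - (alpha * frame_F X Y p * frame_F (E k) Z p).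
Proof.
move=> Xs Ys Zs; rewrite Fk.
have As U : smooth_vfield U -> smooth_fun (oneform_app A U).
  exact: smooth_connection_form.
have second U V : smooth_vfield U -> smooth_vfield V ->
    g p (E k p) (Dc U (Dc V Z) p) =
    Xderiv U (Xderiv V (oneform_app (e k) Z)) p -
    s * (Xderiv U (oneform_app A V) p * g p (E k' p) (Z p) +
         A p (V p) * Xderiv U (oneform_app (e k') Z) p) -
    s * (A p (U p) * (Xderiv V (oneform_app (e k') Z) p +
                      s * (A p (V p) * g p (E k p) (Z p)))).
  move=> Us Vs; have sm := smooth_funM (As _ Vs) (cs k' Zs).
  have D1 := congr1 (fun f => Xderiv U f p) (Hk Vs Zs).
  have D2 := XderivB U p (smooth_Xderiv Vs (cs k Zs))
    (smooth_funM (@smooth_fun_cst _ _ M s) sm).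
  have D3 := XderivM U p (@smooth_fun_cst _ _ M s) sm.
  have D4 := XderivM U p (As _ Vs) (cs k' Zs).
  have D5 := Xderiv_cst U s p.
  have H1 := congr1 (fun f => f p) (Hk Us (Dc_smooth Vs Zs)).
  have H2 := congr1 (fun f => f p) (Hk' Vs Zs).
  have solve (G t1 t2 t3 t4 t5 t6 au av z' xz b c : R) :
    G = t1 - s * (au * z') -> t1 = t2 -> t2 = t3 - t4 -> t4 = b * (av * xz) + s * t5 ->
    t5 = t6 -> b = 0 -> z' = c -> G = t3 - s * t6 - s * (au * c).
    by move=> -> -> -> -> -> -> ->; ring.
  exact: (solve _ _ _ _ _ _ _ _ _ _ _ _ _ H1 D1 D2 D3 D4 D5 H2).
have s1 := second X Y Xs Ys; have s2 := second Y X Ys Xs.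
have s3 := congr1 (fun f => f p) (Hk (smooth_lie_bracket Xs Ys) Zs).
have br := Xderiv_bracket p Xs Ys (cs k Zs).
have dAp := dA Xs Ys p.
have solve (b1 b2 b3 xy yx xA yA lA z z' xz' yz' ax ay l d : R) :
  b1 = xy - s * (xA * z' + ay * xz') - s * (ax * (yz' + s * (ay * z))) ->
  b2 = yx - s * (yA * z' + ax * yz') - s * (ay * (xz' + s * (ax * z))) ->
  b3 = l - s * (lA * z') -> l = xy - yx -> xA - yA - lA = d ->
  b1 - b2 - b3 = - (d * (s * z')).
  by move=> -> -> -> -> <-; ring.
have split3 u v w : g p (E k p) (u - v - w) =
    g p (E k p) u - g p (E k p) v - g p (E k p) w.
  by rewrite !(metricB gm).
apply: (etrans (split3 _ _ _)).
exact: (solve _ _ _ _ _ _ _ _ _ _ _ _ _ _ _ _ s1 s2 s3 br dAp).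
Qed.

End CurvaturePair.

Lemma frame_F_l j V q : frame_F (E j) V q =
  (j == i1)%:R * e i2 q (V q) - (j == i2)%:R * e i1 q (V q) -
  ((j == i3)%:R * e i4 q (V q) - (j == i4)%:R * e i3 q (V q)).
Proof.
rewrite /frame_F /wedge11 /flat !Eo (eq_sym i1) (eq_sym i2) (eq_sym i3) (eq_sym i4).
ring.
Qed.

Lemma curvature_frame j X Y Z p :
  smooth_vfield X -> smooth_vfield Y -> smooth_vfield Z ->
  g p (E j p) (curvature Dc X Y Z p) =
  - (alpha * frame_F X Y p * frame_F (E j) Z p).
Proof.
have pair k k' s := @curvature_pair k k' s.
move: j; apply: ord5_ind.
(* The signs are those of F on the oriented planes (k, k'). Since F vanishes on [E i5], the last
   pair is degenerate, with factor 0. *)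
- by apply: (pair i1 i2 1) => V q; rewrite frame_F_l /=; ring.
- by apply: (pair i2 i1 (-1)) => V q; rewrite frame_F_l /=; ring.
- by apply: (pair i3 i4 (-1)) => V q; rewrite frame_F_l /=; ring.
- by apply: (pair i4 i3 1) => V q; rewrite frame_F_l /=; ring.
- by apply: (pair i5 i5 0) => V q; rewrite frame_F_l /=; ring.
Qed.

Lemma curvatureE X Y Z W p :
  smooth_vfield X -> smooth_vfield Y -> smooth_vfield Z ->
  inner g (curvature Dc X Y Z) W p = alpha * frame_F X Y p * frame_F Z W p.
Proof.
move=> Xs Ys Zs.
have cE j : g p (E j p) (curvature Dc X Y Z p) * g p (E j p) (W p) =
    - (alpha * frame_F X Y p * frame_F (E j) Z p) * g p (E j p) (W p).
  by rewrite (curvature_frame j p Xs Ys Zs).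
apply: (etrans (metric_frame gm Eo p (curvature Dc X Y Z p) (W p))).
apply: (etrans (eq_bigr _ (fun j _ => cE j))).
rewrite sum_ord5 !frame_F_l /=.
rewrite /frame_F /wedge11 /flat; ring.
Qed.

End Connection.

(** * Spinors *)

Lemma sum_pairs5 (V : nmodType) (f : 'I_5 -> 'I_5 -> V) :
  \sum_(i < 5) \sum_(j < 5 | (i < j)%N) f i j =
  f i1 i2 + f i1 i3 + f i1 i4 + f i1 i5 + (f i2 i3 + f i2 i4 + f i2 i5)
  + (f i3 i4 + f i3 i5) + f i4 i5.
Proof.
under eq_bigr => i _ do rewrite big_mkcond /= sum_ord5.
by rewrite sum_ord5 /= !add0r !addr0.
Qed.

Section Clifford.
Context {K : numFieldType}.
Variable c : 'I_5 -> 'M[K]_4.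
Hypothesis cE : forall i j, c i *m c j + c j *m c i = (- (2 * (i == j)%:R))%:M.

Let two_neq0 : (2 : K) != 0. Proof. by rewrite pnatr_eq0. Qed.

Let cN i j : i != j -> c i * c j = - (c j * c i).
Proof.
move=> /negPf ij; apply/eqP; rewrite -addr_eq0; apply/eqP.
by have := cE i j; rewrite ij mulr0 oppr0 raddf0.
Qed.

Let cc i : c i * c i = -1.
Proof.
have E : (2 : K) *: (c i * c i) = (2 : K) *: (-1).
  have := cE i i; rewrite eqxx mulr1 -scalemx1 scaleNr -scalerN => <-.
  by rewrite scaler_nat mulr2n.
by rewrite -[LHS](scalerK two_neq0) E (scalerK two_neq0).
Qed.

Let J := c i1 * c i2.
Let J' := c i3 * c i4.

Let JJ i j : i != j -> c i * c j * (c i * c j) = -1.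
Proof.
move=> ij; rewrite {1}(cN ij) mulNr mulrA -(mulrA (c j) (c i) (c i)) cc.
by rewrite mulrN1 mulNr cc opprK.
Qed.

Let JC : J * J' = J' * J.
Proof.
have swap k : k != i3 -> k != i4 -> c k * J' = J' * c k.
  by move=> k3 k4; rewrite mulrA (cN k3) mulNr -mulrA (cN k4) mulrN opprK mulrA.
by rewrite -mulrA swap // mulrA swap // mulrA.
Qed.

(* The columns of [J + J'] are killed by [J - J'] because the two products of
   gammas commute and have the same square.  As [c i1] anticommutes with [J] and
   commutes with [J'], it exchanges [J - J'] and [J + J'] up to sign, so these
   two matrices have the same rank; it is at least 2 since their sum 2 J is
   invertible. *)
Lemma clifford_kernel : exists x y : 'cV[K]_4,
  [/\ c i1 *m (c i2 *m x) = c i3 *m (c i4 *m x),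
      c i1 *m (c i2 *m y) = c i3 *m (c i4 *m y) &
      forall z1 z2 : K, z1 *: x + z2 *: y = 0 -> z1 = 0 /\ z2 = 0].
Proof.
pose S := J + J'; pose D := J - J'.
have DS : D *m S = 0.
  rewrite mulmxE /D /S mulrDr !mulrBl JC subrKA.
  by rewrite (@JJ i1 i2) // (@JJ i3 i4) // subrr.
have cu : c i1 \in unitmx.
  have E : c i1 *m - c i1 = 1%:M by rewrite mulmxN mulmxE cc opprK.
  by have [] := mulmx1_unit E.
have Ju : J \in unitmx.
  have E : J *m - J = 1%:M by rewrite mulmxN mulmxE JJ // opprK.
  by have [] := mulmx1_unit E.
have cD : c i1 *m D = - S *m c i1.
  have cJ : c i1 * J = - (J * c i1) by rewrite /J -mulrA (@cN i2 i1) // mulrN opprK.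
  have cJ' : c i1 * J' = J' * c i1.
    rewrite /J' mulrA (@cN i1 i3) // mulNr -(mulrA (c i3) (c i1)) (@cN i1 i4) //.
    by rewrite mulrN opprK mulrA.
  by rewrite !mulmxE mulrBr cJ cJ' mulNr mulrDl opprD.
have rDS : \rank D = \rank S.
  have cf : row_full (c i1) by rewrite row_full_unit.
  have <- : \rank (c i1 *m D) = \rank D by rewrite (eqmxMfull D cf).
  by rewrite cD mxrankMfree ?row_free_unit // mxrank_opp.
have r2 : (1 < \rank S)%N.
  have := mxrank_add S D; rewrite rDS addnn.
  have -> : S + D = 2 *: J by rewrite /S /D addrACA subrr addr0 scaler_nat mulr2n.
  rewrite mxrank_scale_nz // (mxrank_unit Ju).
  by case: (\rank S) => [|[|]].
(* [row_base] handles row spaces; the transposed rows of [B] form a basis of the column space of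
   [S], and two of them are the witnesses. *)
pose B := row_base S^T.
have r2' : (1 < \rank S^T)%N by rewrite mxrank_tr.
pose j0 : 'I_(\rank S^T) := Ordinal (ltnW r2'); pose j1 := Ordinal r2'.
have kerB j : D *m (row j B)^T = 0.
  have /submxP[u ->] : (row j B <= S^T)%MS.
    by rewrite (submx_trans (row_sub j B)) // eq_row_base.
  by rewrite trmx_mul trmxK mulmxA DS mul0mx.
have eqB j : c i1 *m (c i2 *m (row j B)^T) = c i3 *m (c i4 *m (row j B)^T).
  have /eqP := kerB j; rewrite mulmxBl subr_eq0 => /eqP.
  by rewrite !mulmxA.
exists (row j0 B)^T, (row j1 B)^T; split=> // z1 z2 z0.
have : z1 *: delta_mx 0 j0 + z2 *: delta_mx 0 j1 = 0 :> 'rV[K]_(\rank S^T).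
  apply: (row_free_inj (row_base_free S^T)).
  rewrite mul0mx mulmxDl -!scalemxAl -!rowE.
  by apply: trmx_inj; rewrite linearD !linearZ /= z0 trmx0.
move=> /rowP z0'; have := z0' j0; have := z0' j1; rewrite !mxE /=.
by rewrite !mulr0 !mulr1 addr0 add0r => -> ->.
Qed.

End Clifford.

Lemma sum_pairs_12_34 (K : pzRingType) (V : lmodType K)
    (f : 'I_5 -> 'I_5 -> K) (v : 'I_5 -> 'I_5 -> V) :
  [/\ f i1 i3 = 0, f i1 i4 = 0, f i1 i5 = 0 & f i2 i3 = 0] ->
  [/\ f i2 i4 = 0, f i2 i5 = 0, f i3 i5 = 0 & f i4 i5 = 0] ->
  \sum_(i < 5) \sum_(j < 5 | (i < j)%N) f i j *: v i j =
  f i1 i2 *: v i1 i2 + f i3 i4 *: v i3 i4.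
Proof.
move=> [f13 f14 f15 f23] [f24 f25 f35 f45].
by rewrite sum_pairs5 f13 f14 f15 f23 f24 f25 f35 f45 !scale0r !addr0.
Qed.

(** * Curvature operator and Ricci tensor *)

Section CurvatureConsequences.
Context {R : realType} {M : manifold R 5}.
Variables (g : bilinear_field M) (E : 'I_5 -> vfield M) (phi : endo M).
Hypothesis gm : riemannian_metric g.
Hypothesis Es : forall i, smooth_vfield (E i).
Hypothesis Eo : forall i j p, g p (E i p) (E j p) = (i == j)%:R.
Hypothesis phis : smooth_endo phi.
Hypothesis PhiE : eq_two (Phi g phi) (fun X Y p =>
  wedge11 (flat g (E i1)) (flat g (E i2)) X Y p +
  wedge11 (flat g (E i3)) (flat g (E i4)) X Y p).
Implicit Types (p : M) (X Y Z W : vfield M) (b : twotensor M).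

Local Notation F := (frame_F g E).

Lemma frame_F_val i j p : F (E i) (E j) p =
  (i == i1)%:R * (i2 == j)%:R - (i == i2)%:R * (i1 == j)%:R -
  ((i == i3)%:R * (i4 == j)%:R - (i == i4)%:R * (i3 == j)%:R).
Proof. by rewrite (frame_F_l Eo) /flat !Eo. Qed.

Lemma frame_F_val0 p :
  [/\ F (E i1) (E i3) p = 0, F (E i1) (E i4) p = 0, F (E i1) (E i5) p = 0 &
      F (E i2) (E i3) p = 0] /\
  [/\ F (E i2) (E i4) p = 0, F (E i2) (E i5) p = 0, F (E i3) (E i5) p = 0 &
      F (E i4) (E i5) p = 0].
Proof. by split; split; rewrite frame_F_val /=; ring. Qed.

Lemma frame_F_val34 p : F (E i3) (E i4) p = -1.
Proof. by rewrite frame_F_val /=; ring. Qed.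

Lemma inner_two_F b p : inner_two E b F p = b (E i1) (E i2) p - b (E i3) (E i4) p.
Proof.
have [f1 f2] := frame_F_val0 p.
have := @sum_pairs_12_34 R R^o (fun i j => F (E i) (E j) p)
  (fun i j => b (E i) (E j) p) f1 f2.
rewrite (frame_F_frame Eo) frame_F_val34 scale1r scaleN1r => <-.
by apply: eq_bigr => i _; apply: eq_bigr => j _; exact: mulrC.
Qed.

Variables (D : connection M) (alpha : R).
Hypothesis RE : forall X Y Z W p,
  smooth_vfield X -> smooth_vfield Y -> smooth_vfield Z ->
  inner g (curvature D X Y Z) W p = alpha * F X Y p * F Z W p.

Lemma curvature_operatorE b Z W p : smooth_vfield Z ->
  curvature_operator g E D b Z W p =
  alpha * (b (E i1) (E i2) p - b (E i3) (E i4) p) * F Z W p.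
Proof.
move=> Zs; rewrite -inner_two_F /inner_two mulr_sumr mulr_suml.
apply: eq_bigr => i _; rewrite mulr_sumr mulr_suml; apply: eq_bigr => j _.
rewrite (RE W p (Es i) (Es j) Zs).
have assoc (x y z t : R) : x * (y * z * t) = y * (x * z) * t by ring.
exact: assoc.
Qed.

Lemma curvature_operator_u2 b : twoform b -> in_u2 phi (curvature_operator g E D b).
Proof.
move=> [bs _ _]; split; first split.
- move=> X Y Xs Ys.
  have -> : curvature_operator g E D b X Y = fun p =>
      alpha * (b (E i1) (E i2) p - b (E i3) (E i4) p) * F X Y p.
    by apply/funext => p; exact: curvature_operatorE.
  apply: smooth_funM; last exact: (smooth_frame_F gm Es Xs Ys).
  apply: smooth_funM; first exact: smooth_fun_cst.
  exact: (smooth_funB (bs _ _ (Es i1) (Es i2)) (bs _ _ (Es i3) (Es i4))).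
- move=> X Y Xs Ys p; rewrite (curvature_operatorE b Y p Xs).
  by rewrite (curvature_operatorE b X p Ys) (frame_FC g E X) mulrN.
- move=> X Y Z f Xs Ys Zs fs p.
  rewrite (curvature_operatorE b Z p (smooth_vfieldZD fs Xs Ys)).
  rewrite (curvature_operatorE b Z p Xs) (curvature_operatorE b Z p Ys).
  by rewrite (frame_F_linear E gm); ring.
- move=> X Y Xs Ys p.
  rewrite (curvature_operatorE b Y p Xs).
  rewrite (curvature_operatorE b (endo_app phi Y) p (phis.2 _ Xs)).
  by rewrite (frame_F_phi gm Es Eo phis PhiE).
Qed.

(** The factor 2 is the square norm of F, by which [proj_two] divides. *)
Lemma curvature_operator_proj b :
  eq_two (curvature_operator g E D b) (fun X Y p => 2 * alpha * proj_two E F b X Y p).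
Proof.
move=> X Y Xs Ys p; rewrite (curvature_operatorE b Y p Xs) /proj_two.
rewrite !inner_two_F (frame_F_frame Eo) frame_F_val34.
have half (x y z : R) : x * y * z = 2 * x * (y / (1 - -1) * z) by field.
exact: half.
Qed.

(** The trace of F ⊗ F is the square of the skew matrix of F, which is minus the projection onto the
    orthogonal complement of [E i5]. *)
Lemma ricciE i j p :
  ricci g E D (E i) (E j) p = - alpha * ((i == j) && (i != i5))%:R.
Proof.
have rE k : inner g (curvature D (E k) (E i) (E j)) (E k) p =
    alpha * F (E k) (E i) p * F (E j) (E k) p by rewrite (RE _ _ (Es k) (Es i) (Es j)).
rewrite /ricci; apply: (etrans (eq_bigr _ (fun k _ => rE k))).
rewrite sum_ord5 !frame_F_val.
by clear rE; move: i j; apply: ord5_ind; apply: ord5_ind => /=; ring.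
Qed.

End CurvatureConsequences.

(** * Parallel spinors *)

Section ParallelSpinors.
Context {R : realType} {M : manifold R 5}.
Variables (c : 'I_5 -> 'M[R[i]]_4) (g : bilinear_field M) (E : 'I_5 -> vfield M).
Hypothesis Eo : forall i j p, g p (E i p) (E j p) = (i == j)%:R.
Variable x : 'cV[R[i]]_4.
Hypothesis cx : c i1 *m (c i2 *m x) = c i3 *m (c i4 *m x).

Local Notation F := (frame_F g E).

(** The factor [t] lets one computation serve twice: [t = 1] for the Clifford action of F,
    [t = A p (X p)] for the spin connection. *)
Let sumF (t : R) p : \sum_(i < 5) \sum_(j < 5 | (i < j)%N)
  (t * F (E i) (E j) p)%:C%C *: (c i *m (c j *m x)) = 0.
Proof.
have [[f13 f14 f15 f23] [f24 f25 f35 f45]] := frame_F_val0 Eo p.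
have z u : u = 0 -> (t * u)%:C%C = 0 :> R[i] by move=> ->; rewrite mulr0.
apply: (etrans (sum_pairs_12_34 (f := fun i j => (t * F (E i) (E j) p)%:C%C)
  (fun i j => c i *m (c j *m x)) _ _)); [by split; exact: z|by split; exact: z|].
rewrite (frame_F_frame Eo) (frame_F_val34 Eo) cx -scalerDl -rmorphD mulr1 mulrN1.
by rewrite subrr scale0r.
Qed.

Lemma clifford_two_F p : clifford_two c E F (fun=> x) p = 0.
Proof.
rewrite -[RHS](sumF 1 p); apply: eq_bigr => i _; apply: eq_bigr => j _.
by rewrite mul1r.
Qed.

Lemma constant_parallel_spinor (D : connection M) (A : oneform M) :
  (forall i j X p, smooth_vfield X ->
    inner g (D X (E i)) (E j) p = A p (X p) * F (E i) (E j) p) ->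
  parallel_spinor c g E D (fun=> x).
Proof.
move=> DA; split=> [k|X Xs p]; first by split; exact: smooth_fun_cst.
rewrite /spin_connection.
have -> : spinor_deriv X (fun=> x) p = 0.
  apply/matrixP => k l; rewrite !mxE.
  by rewrite (Xderiv_cst X (complex.Re (x k 0))) (Xderiv_cst X (complex.Im (x k 0))).
have s0 : \sum_(i < 5) \sum_(j < 5 | (i < j)%N)
    (inner g (D X (E i)) (E j) p)%:C%C *: (c i *m (c j *m x)) = 0.
  rewrite -[RHS](sumF (A p (X p)) p); apply: eq_bigr => i _; apply: eq_bigr => j _.
  by rewrite DA.
by rewrite s0 scaler0 addr0.
Qed.

End ParallelSpinors.

(** * Transfer of the structure equations to M and conclusion *)

Theorem theorem5p1 (R : realType) (a1 a2 a3 a4 : R)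
  (ha : a1 * a4 = a2 * a3) :
  let alpha := - (2 * ((a1 - a3) * (2 * a1 + a3) + (a2 - a4) * (2 * a2 + a4))) in
  forall (G : lieGroup R 6) (e1 e2 e3 e4 e5 A2 : oneform G)
    (HG_basis : left_invariant_basis [tuple e1; e2; e3; e4; e5; A2])
    (HG_struct : structure_equations a1 a2 a3 a4 alpha e1 e2 e3 e4 e5 A2)
    (M : manifold R 5) (iota : M -> G) (Hiota : submanifold iota),
  let e : 'I_5 -> oneform M :=
    fun i => pullback iota (tnth [tuple e1; e2; e3; e4; e5] i) in
  forall (He : coframe_independent e)
    (g : bilinear_field M) (xi : vfield M) (eta : oneform M) (phi : endo M)
    (Hacm : almost_contact_metric g xi eta phi)
    (E : 'I_5 -> vfield M)
    (HEe : forall i p v, flat g (E i) p v = e i p v)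
    (HE : adapted_frame g eta phi E),
  let F : twotensor M := fun X Y p =>
    wedge11 (e i1) (e i2) X Y p - wedge11 (e i3) (e i4) X Y p in
  let N := nijenhuis g eta phi in
  generalized_quasi_sasaki g xi eta phi /\
  [/\ forall X Y, smooth_vfield X -> smooth_vfield Y ->
        forall p, N xi X Y p = 2 * d1 eta X Y p,
      totally_skew N <-> a3 = 0 /\ a4 = 0 &
      traceless_cyclic E N <-> a1 = 0 /\ a2 = 0] /\
  (forall X Y Z, smooth_vfield X -> smooth_vfield Y -> smooth_vfield Z ->
     forall p, d2 F X Y Z p = 0) /\
  forall Dg Dc : connection M,
    levi_civita g Dg -> canonical_connection g xi eta phi Dg Dc ->
    [/\ forall b, twoform b -> in_u2 phi (curvature_operator g E Dc b),
        exists k : R, forall b, twoform b ->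
          eq_two (curvature_operator g E Dc b)
                 (fun X Y p => k * proj_two E F b X Y p) &
        forall X Y Z W, smooth_vfield X -> smooth_vfield Y ->
          smooth_vfield Z -> smooth_vfield W ->
          forall p, inner g (curvature Dc X Y Z) W p
                    = alpha * F X Y p * F Z W p] /\
    (forall i j p, ricci g E Dc (E i) (E j) p
                   = - alpha * ((i == j) && (i != i5))%:R) /\
    forall c : 'I_5 -> 'M[R[i]]_4, clifford_module c ->
      exists Psi1 Psi2 : spinor M,
        [/\ parallel_spinor c g E Dc Psi1, parallel_spinor c g E Dc Psi2,
            forall p, clifford_two c E F Psi1 p = 0 /\
                      clifford_two c E F Psi2 p = 0 &
            forall p (z1 z2 : R[i]),
              z1 *: Psi1 p + z2 *: Psi2 p = 0 -> z1 = 0 /\ z2 = 0].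
Proof.
move=> alpha G e1 e2 e3 e4 e5 A2 sB HS M iota sub e He g xi eta phi
  Hacm E HEe [Es Eo PhiE etaE5] F N.
have [gm [[xis _ etaE phis] _]] := Hacm.
(* Both ξ and E_5 are metrically dual to η, hence equal; the preceding sections are written with
   [E i5] and its dual form. *)
have xiE : xi = E i5.
  apply/funext => p; apply: (frame_ext gm Eo (p := p)) => i.
  by rewrite (metricC gm p _ (xi p)) -etaE etaE5 /flat (metricC gm p (E i5 p)).
have eta5 : eta = flat g (E i5).
  by apply/funext => p; apply/funext => v; exact: etaE5.
have eE i : e i = flat g (E i).
  by apply/funext => p; apply/funext => v; rewrite HEe.
have FE : F = frame_F g E by rewrite /F !eE.
rewrite FE; clear F FE.
subst xi eta.
pose A := pullback iota A2.
have smoothG i : smooth_oneform (tnth [tuple e1; e2; e3; e4; e5; A2] i).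
  exact: (sB.1 i).1.
(* The comparison at a single point that [pullback_structure_equation] asks for. *)
have pulled (X : vfield M) (X' : vfield G) p : X' (iota p) = dmap iota p (X p) ->
    A p (X p) = A2 (iota p) (X' (iota p)) /\ forall i, flat g (E i) p (X p) =
      tnth [tuple e1; e2; e3; e4; e5] i (iota p) (X' (iota p)).
  by move=> ->; split=> // i; rewrite HEe.
have tE : (tnth [tuple e1; e2; e3; e4; e5] i1 = e1) *
    (tnth [tuple e1; e2; e3; e4; e5] i2 = e2) *
    (tnth [tuple e1; e2; e3; e4; e5] i3 = e3) *
    (tnth [tuple e1; e2; e3; e4; e5] i4 = e4) *
    (tnth [tuple e1; e2; e3; e4; e5] i5 = e5) by [].
have [[S1 S2 S3 S4] [S5 S6]] := HS.
have iotas : smooth_map iota by have [] := sub.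
have pb i (b : twotensor G) (c : twotensor M) :=
  @pullback_structure_equation _ _ _ _ sB _ _ iota _ b c iotas (smoothG i).
have dE k : eq_two (d1 (flat g (E k))) (frame_d g E A a1 a2 a3 a4 k).
  rewrite -eE; move: k; apply: ord5_ind.
  - apply: (pb (@Ordinal 6 0 isT) _ _ S1) => X Y X' Y' p EX EY.
    have [[AX eX] [AY eY]] := (pulled _ _ _ EX, pulled _ _ _ EY).
    by rewrite /frame_d /wedge11 AX AY !eX !eY !tE /=; ring.
  - apply: (pb (@Ordinal 6 1 isT) _ _ S2) => X Y X' Y' p EX EY.
    have [[AX eX] [AY eY]] := (pulled _ _ _ EX, pulled _ _ _ EY).
    by rewrite /frame_d /wedge11 AX AY !eX !eY !tE /=; ring.
  - apply: (pb (@Ordinal 6 2 isT) _ _ S3) => X Y X' Y' p EX EY.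
    have [[AX eX] [AY eY]] := (pulled _ _ _ EX, pulled _ _ _ EY).
    by rewrite /frame_d /wedge11 AX AY !eX !eY !tE /=; ring.
  - apply: (pb (@Ordinal 6 3 isT) _ _ S4) => X Y X' Y' p EX EY.
    have [[AX eX] [AY eY]] := (pulled _ _ _ EX, pulled _ _ _ EY).
    by rewrite /frame_d /wedge11 AX AY !eX !eY !tE /=; ring.
  - apply: (pb (@Ordinal 6 4 isT) _ _ S5) => X Y X' Y' p EX EY.
    have [[AX eX] [AY eY]] := (pulled _ _ _ EX, pulled _ _ _ EY).
    by rewrite /frame_d /wedge11 AX AY !eX !eY !tE /=; ring.
have dA : eq_two (d1 A) (fun X Y p => alpha * frame_F g E X Y p).
  apply: (pb (@Ordinal 6 5 isT) _ _ S6) => X Y X' Y' p EX EY.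
  have [[_ eX] [_ eY]] := (pulled _ _ _ EX, pulled _ _ _ EY).
  by rewrite /frame_F /wedge11 !eX !eY !tE.
split; last split; last split.
- split; [exact: Hacm| |exact: (killing_frame5 gm Es Eo dE)].
  move=> X Y Z Xs Ys Zs Xo Yo Zo p.
  have [x5 y5 z5] : [/\ g p (E i5 p) (X p) = 0, g p (E i5 p) (Y p) = 0 &
      g p (E i5 p) (Z p) = 0].
    by split; rewrite (metricC gm); [exact: Xo|exact: Yo|exact: Zo].
  rewrite (nijenhuisE gm Es Eo phis PhiE dE X p Ys Zs).
  rewrite (d2_PhiE gm Es Eo phis PhiE dE p Xs Ys Zs).
  (* Every term of both expressions contains a component along ξ of one of the three fields. *)
  rewrite /nijenhuis_frame /wedge21 /wedge11 /flat x5 y5 z5.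
  by split; ring.
- split.
  + move=> X Y Xs Ys p; apply: (etrans (nijenhuisE gm Es Eo phis PhiE dE _ p Xs Ys)).
    apply: (etrans (nijenhuis_frame5 Eo A a1 a2 a3 a4 X Y p)).
    exact: (congr1 (fun z => 2 * z) (esym (dE i5 X Y Xs Ys p))).
  + exact: (nijenhuis_skewE gm Es Eo phis PhiE dE (manifold_nonempty M)).
  + exact: (nijenhuis_cyclicE gm Es Eo phis PhiE dE (manifold_nonempty M)).
- by move=> X Y Z Xs Ys Zs p; exact: (d2_F gm Es dE p Xs Ys Zs).
move=> Dg Dc LC CC.
have RE X Y Z W p (Xs : smooth_vfield X) (Ys : smooth_vfield Y)
    (Zs : smooth_vfield Z) :=
  curvatureE gm Es Eo phis PhiE dE dA LC CC W p Xs Ys Zs.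
split; last split.
- split.
  + by move=> b; exact: (curvature_operator_u2 gm Es Eo phis PhiE RE).
  + by exists (2 * alpha) => b _; exact: (curvature_operator_proj Es Eo RE b).
  + by move=> X Y Z W Xs Ys Zs _ p; exact: RE.
- exact: (ricciE Es Eo RE).
move=> c cM; have [x [y [cx cy xy]]] := clifford_kernel cM.
have DA i j (X : vfield M) p (Xs : smooth_vfield X) :=
  connection_frame gm Es Eo phis PhiE dE LC CC i j p Xs.
exists (fun=> x), (fun=> y); split.
- exact: (constant_parallel_spinor Eo cx DA).
- exact: (constant_parallel_spinor Eo cy DA).
- by move=> p; split; [exact: (clifford_two_F Eo cx)|exact: (clifford_two_F Eo cy)].
- by move=> _; exact: xy.
Qed.
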